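(* Let $d\in\mathbb{N}$, $s>1$ and define $$S:=\sum_{k=1}^\infty\frac{1}{(k^2+1)^{\frac{s}{2(s-1)}}}.$$ Then $$\lim_{n\to+\infty}\frac{a_n\big(id:H^{s,2}_{\mathrm{mix}}(\mathbb{T}^d)\to H^1(\mathbb{T}^d)\big)}{n^{-s+1}}=(2d)^{s-1}(2S+1)^{(s-1)(d-1)} .$$
   Context: $\mathbb{T}^d$ is the $d$-dimensional torus ($[0,2\pi]^d$ with endpoints identified) with the probability measure $(2\pi)^{-d}d\boldsymbol{x}$; $\hat f(\boldsymbol{k})=(2\pi)^{-d}\int_{\mathbb{T}^d}f(\boldsymbol{x})e^{-i\boldsymbol{k}\boldsymbol{x}}\,d\boldsymbol{x}$, $\boldsymbol{k}\in\mathbb{Z}^d$. $H^{s,2}_{\mathrm{mix}}(\mathbb{T}^d)$ is the Hilbert space of all $f\in L_1(\mathbb{T}^d)$ with $\|f|H^{s,2}_{\mathrm{mix}}(\mathbb{T}^d)\|:=\big(\sum_{\boldsymbol{k}\in\mathbb{Z}^d}\prod_{i=1}^d(1+|k_i|^2)^{s}|\hat f(\boldsymbol{k})|^2\big)^{1/2}<\infty$. $H^1(\mathbb{T}^d)$ is the isotropic periodic Sobolev space of smoothness $1$ with norm $\|f|H^1(\mathbb{T}^d)\|:=\big(\sum_{\boldsymbol{k}\in\mathbb{Z}^d}(1+\sum_{j=1}^d|k_j|^2)|\hat f(\boldsymbol{k})|^2\big)^{1/2}$. $id$ denotes the identity (embedding) operator. For a continuous linear operator $T:X\to Y$ between Banach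 spaces and $n\in\mathbb{N}$, the approximation numbers are $a_n(T)=\inf\{\|T-A\|: A\in\mathcal{L}(X,Y),\ \mathrm{rank}(A)<n\}$. *)

(* Defs.v *)
From HB Require Import structures.
From mathcomp Require Import all_boot all_order all_algebra.
From mathcomp Require Import generic_quotient ring_quotient.
From mathcomp Require Import all_classical all_reals all_analysis.
From mathcomp Require Import measurable_realfun.
From mathcomp Require Import complex ring lra.

Set Implicit Arguments.
Unset Strict Implicit.
Unset Printing Implicit Defensive.

Import Order.TTheory GRing.Theory Num.Theory.
Import numFieldNormedType.Exports.
Import complex.ComplexField.Normc.

Local Open Scope classical_set_scope.
Local Open Scope ring_scope.
Local Open Scope complex_scope.
Local Open Scope quotient_scope.

Section torus_measure.
Variable R : realType.

Lemma twopi_gt0 : 0 < 2 * pi :> R.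
Proof. by rewrite mulr_gt0// pi_gt0. Qed.

Definition circle_measure : probability (measurableTypeR R) R :=
  uniform_prob twopi_gt0.

Definition tuple_cons n (xt : measurableTypeR R * n.-tuple (measurableTypeR R)) :
  n.+1.-tuple (measurableTypeR R) := [tuple of xt.1 :: xt.2].

Lemma measurable_tuple_cons n : measurable_fun setT (@tuple_cons n).
Proof. exact: measurable_cons. Qed.

HB.instance Definition _ n :=
  isMeasurableFun.Build _ _ _ _ (@tuple_cons n) (@measurable_tuple_cons n).

(* (2 pi)^-d dx on [0, 2 pi]^d, as a Borel probability measure on R^d which does
   not charge the complement of the cube.  The identification of endpoints is
   irrelevant, since functions are only considered up to a.e. equality. *)
Fixpoint torus_measure d : probability (d.-tuple (measurableTypeR R)) R :=
  match d with
  | 0 => \d_([tuple])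
  | d'.+1 => distribution (circle_measure \x torus_measure d')%E (@tuple_cons d')
  end.
End torus_measure.

Section complex_L1.
Context d (T : measurableType d) (R : realType) (mu : {measure set T -> \bar R}).

Definition cintegrable (f : T -> R[i]) : Prop :=
  mu.-integrable setT (EFin \o (fun x => complex.Re (f x))) /\
  mu.-integrable setT (EFin \o (fun x => complex.Im (f x))).

Definition cintegral (f : T -> R[i]) : R[i] :=
  (\int[mu]_x complex.Re (f x))%R +i* (\int[mu]_x complex.Im (f x))%R.

Lemma cintegrableD f g :
  cintegrable f -> cintegrable g -> cintegrable (fun x => f x + g x).
Proof.
move=> [f1 f2] [g1 g2]; split.
- rewrite [X in _.-integrable _ X](_ : _ = (EFin \o (fun x => complex.Re (f x))) \+
    (EFin \o (fun x => complex.Re (g x))))%E; first exact: integrableD.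
  by apply/funext => x /=; case: (f x) (g x) => [? ?] [? ?].
- rewrite [X in _.-integrable _ X](_ : _ = (EFin \o (fun x => complex.Im (f x))) \+
    (EFin \o (fun x => complex.Im (g x))))%E; first exact: integrableD.
  by apply/funext => x /=; case: (f x) (g x) => [? ?] [? ?].
Qed.

Lemma cintegralD f g : cintegrable f -> cintegrable g ->
  cintegral (fun x => f x + g x) = cintegral f + cintegral g.
Proof.
move=> [f1 f2] [g1 g2]; rewrite /cintegral.
rewrite -[RHS]/((_ + _) +i* (_ + _)) -!RintegralD//.
by congr (_ +i* _); apply: eq_Rintegral => x _; case: (f x) (g x) => [? ?] [? ?].
Qed.

Let ReM (c z : R[i]) : complex.Re (c * z) =
  complex.Re c * complex.Re z - complex.Im c * complex.Im z.
Proof. by case: c z => [? ?] [? ?]. Qed.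

Let ImM (c z : R[i]) : complex.Im (c * z) =
  complex.Re c * complex.Im z + complex.Im c * complex.Re z.
Proof. by case: c z => [? ?] [? ?]. Qed.

Let intZ (c : R) (f : T -> R) : mu.-integrable setT (EFin \o f) ->
  mu.-integrable setT (EFin \o (fun x => c * f x)).
Proof.
move=> fi.
rewrite [X in _.-integrable _ X](_ : _ = fun x => c%:E * (EFin \o f) x)%E;
  last by apply/funext => x /=; rewrite EFinM.
exact: integrableZl.
Qed.

Lemma cintegrableZ c f : cintegrable f -> cintegrable (fun x => c * f x).
Proof.
move=> [f1 f2]; split.
- rewrite [X in _.-integrable _ X](_ : _ =
    (EFin \o (fun x => complex.Re c * complex.Re (f x))%R) \-
    (EFin \o (fun x => complex.Im c * complex.Im (f x))%R))%E;
    first by apply: integrableB => //; exact: intZ.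
  by apply/funext => x /=; rewrite ReM EFinB.
- rewrite [X in _.-integrable _ X](_ : _ =
    (EFin \o (fun x => complex.Re c * complex.Im (f x))%R) \+
    (EFin \o (fun x => complex.Im c * complex.Re (f x))%R))%E;
    first by apply: integrableD => //; exact: intZ.
  by apply/funext => x /=; rewrite ImM EFinD.
Qed.

Lemma cintegralZ c f : cintegrable f ->
  cintegral (fun x => c * f x) = c * cintegral f.
Proof.
move=> [f1 f2]; rewrite /cintegral.
have -> : c * ((\int[mu]_x complex.Re (f x))%R +i* (\int[mu]_x complex.Im (f x))%R)
  = (complex.Re c * (\int[mu]_x complex.Re (f x))%R
     - complex.Im c * (\int[mu]_x complex.Im (f x))%R) +i*
    (complex.Re c * (\int[mu]_x complex.Im (f x))%R
     + complex.Im c * (\int[mu]_x complex.Re (f x))%R).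
  by case: c.
rewrite -!RintegralZl// -RintegralB//; try exact: intZ.
rewrite -RintegralD//; try exact: intZ.
by congr (_ +i* _); apply: eq_Rintegral => x _; rewrite (ReM, ImM).
Qed.

Definition L1fun_pred : {pred T -> R[i]} := [pred f | `[< cintegrable f >]].

Lemma L1fun_submod_closed : submod_closed L1fun_pred.
Proof.
split.
  by apply/asboolP; split; exact: integrable0.
move=> a f g /asboolP fi /asboolP gi; apply/asboolP.
by apply: cintegrableD => //; exact: cintegrableZ.
Qed.

HB.instance Definition _ :=
  GRing.isSubmodClosed.Build _ _ L1fun_pred L1fun_submod_closed.

Record L1fun := MkL1fun { L1fun_val :> T -> R[i]; _ : L1fun_val \in L1fun_pred }.
HB.instance Definition _ := [isSub for L1fun_val].
HB.instance Definition _ := [Choice of L1fun by <:].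
HB.instance Definition _ := [SubChoice_isSubLmodule of L1fun by <:].

Definition ae0_pred : {pred L1fun} :=
  [pred f : L1fun | `[< \forall x \ae mu, f x = 0 >]].

Lemma ae0_submod_closed : submod_closed ae0_pred.
Proof.
split.
  by apply/asboolP; exact: aeW.
move=> a f g /asboolP f0 /asboolP g0; apply/asboolP.
move: f0 g0; apply: filterS2 => x fx gx.
by have -> : (a *: f + g) x = a * f x + g x by []; rewrite fx gx mulr0 addr0.
Qed.

HB.instance Definition _ :=
  GRing.isSubmodClosed.Build _ _ ae0_pred ae0_submod_closed.

(* Classes of integrable complex functions modulo a.e. equality: see L1_eqP. *)
Definition L1 := Quotient.quot ae0_pred.
HB.instance Definition _ := GRing.Zmodule.on L1.
HB.instance Definition _ := EqQuotient.on L1.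

Lemma L1_eqP (f g : L1fun) :
  \pi_L1 f = \pi_L1 g <-> \forall x \ae mu, f x = g x.
Proof.
have -> : (\pi_L1 f = \pi_L1 g) <-> (f - g \in ae0_pred).
  by rewrite Quotient.idealrBE; split => [->|/eqP].
split=> [/asboolP|fg]; last first.
  apply/asboolP; move: fg; apply: filterS => x fg.
  have -> : (f - g) x = f x - g x by [].
  by rewrite fg subrr.
apply: filterS => x.
by have -> : (f - g) x = f x - g x by []; move/eqP; rewrite subr_eq0 => /eqP.
Qed.

Definition L1_scale (a : R[i]) (u : L1) : L1 := \pi_L1 (a *: repr u).

Lemma pi_scale a (f : L1fun) : \pi_L1 (a *: f) = L1_scale a (\pi_L1 f).
Proof.
have /L1_eqP rf : \pi_L1 (repr (\pi_L1 f)) = \pi_L1 f by rewrite reprK.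
apply/L1_eqP; move: rf; apply: filterS => x rf.
have E (h : L1fun) : (a *: h) x = a * h x by [].
by rewrite !E rf.
Qed.

Let pi_add (f g : L1fun) : \pi_L1 (f + g) = \pi_L1 f + \pi_L1 g.
Proof. exact: pi_addr. Qed.

Let L1_scaleA a b u : L1_scale a (L1_scale b u) = L1_scale (a * b) u.
Proof.
rewrite -[u]reprK; move: (repr u) => f.
by rewrite -(pi_scale b f) -(pi_scale a) -(pi_scale _ f) scalerA.
Qed.

Let L1_scale1 : left_id 1 L1_scale.
Proof.
by move=> u; rewrite -[u]reprK; move: (repr u) => f; rewrite -pi_scale scale1r.
Qed.

Let L1_scaleDr : right_distributive L1_scale +%R.
Proof.
move=> a u v; rewrite -[u]reprK -[v]reprK; move: (repr u) (repr v) => f g.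
by rewrite -pi_add -!pi_scale -pi_add scalerDr.
Qed.

Let L1_scaleDl u : {morph L1_scale^~ u : a b / a + b}.
Proof.
move=> a b; rewrite -[u]reprK; move: (repr u) => f.
by rewrite -!pi_scale -pi_add scalerDl.
Qed.

HB.instance Definition _ := GRing.Zmodule_isLmodule.Build R[i] L1
  L1_scaleA L1_scale1 L1_scaleDr L1_scaleDl.

Lemma L1_reprP (a : R[i]) (u v : L1) :
  \forall x \ae mu, repr (a *: u + v) x = a * repr u x + repr v x.
Proof.
have /L1_eqP : \pi_L1 (repr (a *: u + v)) = \pi_L1 (a *: repr u + repr v).
  by rewrite reprK pi_add pi_scale !reprK.
exact.
Qed.
End complex_L1.

Section fourier.
Context (R : realType) (d : nat).
Local Notation Td := (d.-tuple (measurableTypeR R)).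
Local Notation mu := (torus_measure R d).

Definition kdot (k : d.-tuple int) (x : Td) : R :=
  \sum_(i < d) (tnth k i)%:~R * tnth x i.

Definition expi (t : R) : R[i] := cos t +i* sin t.

Definition fourier (f : Td -> R[i]) (k : d.-tuple int) : R[i] :=
  cintegral mu (fun x => f x * expi (- kdot k x)).

Let measurable_kdot k : measurable_fun setT (kdot k).
Proof.
apply: measurable_sum => i; apply: measurable_funM => //.
exact: measurable_tnth.
Qed.

Let measurable_cosk k : measurable_fun setT (fun x : Td => cos (- kdot k x)).
Proof.
apply: (@measurableT_comp _ _ _ _ _ _ (@cos R)).
  by apply: continuous_measurable_fun; exact: continuous_cos.
by apply: (@measurableT_comp _ _ _ _ _ _ (@GRing.opp R)).
Qed.

Let measurable_sink k : measurable_fun setT (fun x : Td => sin (- kdot k x)).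
Proof.
apply: (@measurableT_comp _ _ _ _ _ _ (@sin R)).
  by apply: continuous_measurable_fun; exact: continuous_sin.
by apply: (@measurableT_comp _ _ _ _ _ _ (@GRing.opp R)).
Qed.

Let intM (f h : Td -> R) : measurable_fun setT h -> (forall x, `|h x| <= 1) ->
  mu.-integrable setT (EFin \o f) ->
  mu.-integrable setT (EFin \o (fun x => f x * h x)).
Proof.
move=> mh h1 fi; rewrite (_ : _ \o _ = (EFin \o f) \* (EFin \o h))%E//.
apply: integrableMl => //.
exists 1; split => // M M1 x _; exact: le_trans (h1 x) (ltW M1).
Qed.

Lemma cintegrable_expi f k : cintegrable mu f ->
  cintegrable mu (fun x => f x * expi (- kdot k x)).
Proof.
have c1 x : `|cos x : R| <= 1 by rewrite ler_norml cos_geN1 cos_le1.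
have s1 x : `|sin x : R| <= 1 by rewrite ler_norml sin_geN1 sin_le1.
move=> [f1 f2]; split.
- rewrite [X in _.-integrable _ X](_ : _ =
    (EFin \o (fun x => complex.Re (f x) * cos (- kdot k x))%R) \-
    (EFin \o (fun x => complex.Im (f x) * sin (- kdot k x))%R))%E.
    by apply: integrableB => //; apply: intM.
  by apply/funext => x /=; case: (f x).
- rewrite [X in _.-integrable _ X](_ : _ =
    (EFin \o (fun x => complex.Re (f x) * sin (- kdot k x))%R) \+
    (EFin \o (fun x => complex.Im (f x) * cos (- kdot k x))%R))%E.
    by apply: integrableD => //; apply: intM.
  by apply/funext => x /=; case: (f x).
Qed.

Lemma eq_cintegral_ae f g : cintegrable mu f -> cintegrable mu g ->
  (\forall x \ae mu, f x = g x) -> cintegral mu f = cintegral mu g.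
Proof.
move=> [f1 f2] [g1 g2] fg; rewrite /cintegral /Rintegral.
congr (fine _ +i* fine _).
- apply: ae_eq_integral => //; [exact: measurable_int f1|exact: measurable_int g1|].
  by apply: filterS fg => x -> _.
- apply: ae_eq_integral => //; [exact: measurable_int f2|exact: measurable_int g2|].
  by apply: filterS fg => x -> _.
Qed.

Definition L1torus := L1 mu.
HB.instance Definition _ := GRing.Lmodule.on L1torus.

Definition fcoef (u : L1torus) (k : d.-tuple int) : R[i] := fourier (repr u) k.

Let repr_int (u : L1torus) : cintegrable mu (repr u).
Proof. by apply/asboolP; exact: (valP (repr u)). Qed.

Lemma fcoefP a u v k : fcoef (a *: u + v) k = a * fcoef u k + fcoef v k.
Proof.
rewrite /fcoef /fourier.
have iu := cintegrable_expi k (repr_int u).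
have iv := cintegrable_expi k (repr_int v).
rewrite -cintegralZ// -cintegralD//; last exact: cintegrableZ.
apply: eq_cintegral_ae.
- exact: cintegrable_expi.
- by apply: cintegrableD => //; exact: cintegrableZ.
- apply: filterS (L1_reprP a u v) => x ->.
  by rewrite mulrDl mulrA.
Qed.

(* normc is the R-valued modulus (`|_| on R[i] takes its values in R[i]). *)
Definition wsum (w : d.-tuple int -> R) (u : L1torus) : \bar R :=
  \esum_(k in [set: d.-tuple int]) (w k * normc (fcoef u k) ^+ 2)%:E.

Definition wsum_pred w : {pred L1torus} := [pred u | wsum w u < +oo]%E.

Let esumZ (c : R) (t : d.-tuple int -> R) : 0 <= c -> (forall k, 0 <= t k) ->
  (\esum_(k in setT) (t k)%:E < +oo -> \esum_(k in setT) (c * t k)%:E < +oo)%E.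
Proof.
move=> c0 t0 tfin.
apply: (@le_lt_trans _ _ (c%:E * \esum_(k in setT) (t k)%:E)%E).
  apply: ge_ereal_sup => _ [A [finA _] <-].
  rewrite (eq_fsbigr (fun k => c%:E * (t k)%:E)%E); last by move=> k _; rewrite EFinM.
  rewrite -ge0_mule_fsumr; last by move=> k; rewrite lee_fin.
  by apply: lee_wpmul2l; [rewrite lee_fin|apply: esum_ge; exists A].
by apply: lte_mul_pinfty => //; rewrite ge0_fin_numE// esum_ge0.
Qed.

Let normcD2 (a x y : R[i]) :
  normc (a * x + y) ^+ 2 <= 2 * normc a ^+ 2 * normc x ^+ 2 + 2 * normc y ^+ 2.
Proof.
rewrite -mulrA -exprMn -normcM.
move: (a * x) => {a x} [a b]; case: y => [c e].
rewrite /normc !sqr_sqrtr ?addr_ge0 ?sqr_ge0//=.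
rewrite -subr_ge0 (_ : _ - _ = (a - c) ^+ 2 + (b - e) ^+ 2); last by ring.
by rewrite addr_ge0// sqr_ge0.
Qed.

Lemma wsum_submod_closed w : (forall k, 0 <= w k) -> submod_closed (wsum_pred w).
Proof.
move=> w0; split.
  rewrite inE /wsum esum1// => k _; suff -> : fcoef 0 k = 0 by rewrite normc0 expr0n mulr0.
  have := fcoefP (-1) 0 0 k; rewrite scaler0 addr0 mulN1r => ->.
  by rewrite addNr.
move=> a u v; rewrite !inE => ufin vfin.
have w0' z k : (0 <= w k * normc (fcoef z k) ^+ 2)%R.
  by rewrite mulr_ge0// exprn_ge0//; case: (fcoef z k) => p q; exact: sqrtr_ge0.
apply: (@le_lt_trans _ _ (\esum_(k in setT)
  ((2 * normc a ^+ 2) * (w k * normc (fcoef u k) ^+ 2))%:E +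
  \esum_(k in setT) (2 * (w k * normc (fcoef v k) ^+ 2))%:E)%E).
  rewrite -esumD//; last 2 first.
  - by move=> k _; rewrite lee_fin mulr_ge0// mulr_ge0// sqr_ge0.
  - by move=> k _; rewrite lee_fin mulr_ge0.
  apply: le_esum => k _; rewrite fcoefP -EFinD lee_fin.
  rewrite [leRHS](_ : _ = w k * (2 * normc a ^+ 2 * normc (fcoef u k) ^+ 2 +
    2 * normc (fcoef v k) ^+ 2)); last by ring.
  by rewrite ler_wpM2l.
apply: lte_add_pinfty; apply: esumZ => //.
by rewrite mulr_ge0// sqr_ge0.
Qed.

End fourier.

Section sobolev_spaces.
Context (R : realType) (d : nat).
Local Notation L1d := (L1torus R d).

Definition mix_weight (s : R) (k : d.-tuple int) : R :=
  \prod_(i < d) (1 + `|(tnth k i)%:~R : R| ^+ 2) `^ s.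

Definition iso_weight (k : d.-tuple int) : R :=
  1 + \sum_(j < d) `|(tnth k j)%:~R : R| ^+ 2.

Lemma mix_weight_ge0 s k : 0 <= mix_weight s k.
Proof. by apply: prodr_ge0 => i _; exact: powR_ge0. Qed.

Lemma iso_weight_ge0 k : 0 <= iso_weight k.
Proof. by rewrite addr_ge0// sumr_ge0// => j _; exact: sqr_ge0. Qed.

Lemma iso_le_mix_weight s k : 1 <= s -> iso_weight k <= mix_weight s k.
Proof.
move=> s1; rewrite /iso_weight /mix_weight.
apply: (@le_trans _ _ (\prod_(i < d) (1 + `|(tnth k i)%:~R : R| ^+ 2))).
  have H (r : seq 'I_d) (a : 'I_d -> R) : (forall i, 0 <= a i) ->
      1 + \sum_(i <- r) a i <= \prod_(i <- r) (1 + a i).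
    move=> a0; elim: r => [|i r IH]; first by rewrite !big_nil addr0.
    have S0 : 0 <= \sum_(j <- r) a j by apply: sumr_ge0.
    rewrite !big_cons; apply: le_trans (ler_wpM2l _ IH); last by rewrite addr_ge0.
    rewrite -subr_ge0 (_ : _ - _ = a i * \sum_(j <- r) a j); last by ring.
    exact: mulr_ge0.
  by apply: H => i; exact: sqr_ge0.
apply: ler_prod => i _; have h : 1 <= 1 + `|(tnth k i)%:~R : R| ^+ 2.
  by rewrite lerDl sqr_ge0.
rewrite (le_trans ler01 h)/= -[leLHS]powRr1 ?(le_trans ler01)//.
exact: ler_powR.
Qed.

Definition Hmix_pred (s : R) : {pred L1d} := wsum_pred (mix_weight s).
Definition H1iso_pred : {pred L1d} := wsum_pred iso_weight.

HB.instance Definition _ s := GRing.isSubmodClosed.Build _ _ (Hmix_pred s)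
  (wsum_submod_closed (mix_weight_ge0 s)).
HB.instance Definition _ := GRing.isSubmodClosed.Build _ _ H1iso_pred
  (wsum_submod_closed iso_weight_ge0).

Record Hmix (s : R) := MkHmix { Hmix_val :> L1d; _ : Hmix_val \in Hmix_pred s }.
HB.instance Definition _ s := [isSub for @Hmix_val s].
HB.instance Definition _ s := [Choice of Hmix s by <:].
HB.instance Definition _ s := [SubChoice_isSubLmodule of Hmix s by <:].

Record H1iso := MkH1iso { H1iso_val :> L1d; _ : H1iso_val \in H1iso_pred }.
HB.instance Definition _ := [isSub for H1iso_val].
HB.instance Definition _ := [Choice of H1iso by <:].
HB.instance Definition _ := [SubChoice_isSubLmodule of H1iso by <:].

Definition Hmix_norm (s : R) (u : Hmix s) : R :=
  Num.sqrt (fine (wsum (mix_weight s) u)).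

Definition H1iso_norm (u : H1iso) : R := Num.sqrt (fine (wsum iso_weight u)).

Lemma Hmix_sub_H1iso s (s1 : 1 < s) (u : Hmix s) : (u : L1d) \in H1iso_pred.
Proof.
have := valP u; rewrite !inE; apply: le_lt_trans; apply: le_esum => k _.
rewrite lee_fin ler_wpM2r ?sqr_ge0//; exact: iso_le_mix_weight (ltW s1).
Qed.

Definition embed s (s1 : 1 < s) (u : Hmix s) : H1iso := MkH1iso (Hmix_sub_H1iso s1 u).

Lemma embed_is_linear s (s1 : 1 < s) : linear (@embed s s1).
Proof. by move=> a u v; apply/val_inj. Qed.

HB.instance Definition _ s (s1 : 1 < s) :=
  GRing.isLinear.Build R[i] (Hmix s) H1iso _ (embed s1) (embed_is_linear s1).

End sobolev_spaces.

(* For normed spaces (X, nX) and (Y, nY) over R[i].  The norm axioms play no role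
   in the definitions, so nX and nY are plain functions.  A linear operator is
   continuous iff its operator norm is finite. *)
Section approximation_numbers.
Context (R : realType) (X Y : lmodType R[i]) (nX : X -> R) (nY : Y -> R).

Definition opnorm (T : X -> Y) : \bar R :=
  ereal_sup [set (nY (T x))%:E | x in [set x : X | nX x <= 1]].

(* The range is spanned by fewer than n vectors, i.e. its dimension is < n. *)
Definition rank_lt (n : nat) (A : X -> Y) : Prop :=
  exists m (y : 'I_m -> Y), (m < n)%N /\
    forall x, exists c : 'I_m -> R[i], A x = \sum_(i < m) c i *: y i.

Definition approx_number (T : {linear X -> Y}) (n : nat) : \bar R :=
  ereal_inf [set opnorm (fun x => T x - A x) | A in
    [set A : {linear X -> Y} | (opnorm A < +oo)%E /\ rank_lt n A]].

End approximation_numbers.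

(* Main.v *)
From HB Require Import structures.
Require Import Defs.
From mathcomp Require Import all_boot all_order all_algebra.
From mathcomp Require Import generic_quotient ring_quotient.
From mathcomp Require Import all_classical all_reals all_analysis.
From mathcomp Require Import measurable_realfun complex ring lra zify.

Set Implicit Arguments.
Unset Strict Implicit.
Unset Printing Implicit Defensive.

Import Order.TTheory GRing.Theory Num.Theory.
Import numFieldNormedType.Exports.

Local Open Scope classical_set_scope.
Local Open Scope ring_scope.

(** Write lam(k) for the square root of [iso_weight k / mix_weight s k].  In
    Fourier coordinates the embedding multiplies the coefficient of index [k]
    by lam(k) between two weighted l2 spaces, so its n-th approximation number
    is the n-th largest value of lam.  Both halves of this rest on the
    orthonormality of the exponentials ([fcoef_exp]).  Truncating the Fourier series to
    a finite set of frequencies outside of which lam is at most [c] gives an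
    operator of finite rank at distance at most [c] ([approx_number_le]).
    Conversely, an operator of rank less than [n] kills a nonzero trigonometric
    polynomial with [n] given frequencies; if lam is at least [c] on them, the
    embedding shrinks this polynomial at most by the factor [c]
    ([le_approx_number]).

    It remains to count the [k] with lam(k) at least r^(-(s-1)).  With
    a = 1/(2(s-1)), this says that [tensor_weight a k], the product of the
    (1 + k_i^2)^(a + 1/2), is at most r (iso_weight k)^a.  Suppose that the
    coordinate k_j = x is much larger than the other ones, collected in [m].
    Then iso_weight k is about 1 + x^2, its a-th power cancels against the
    factor of x up to (1 + x^2)^(1/2), and the condition becomes |x| <= r w(m),
    where w(m) is the product of the (1 + m_i^2)^(-(a + 1/2)).  The d choices
    of [j] and the two signs of [x] give about 2 d r times the sum of w over
    Z^(d-1), which is (2 S + 1)^(d-1).  The number of solutions is thus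
    asymptotically C r with C = 2 d (2 S + 1)^(d-1), and the approximation
    numbers behave like (n / C)^(-(s-1)).

    Making this rigorous takes one truncation parameter [M].  For the lower
    bound only the [m] in the cube of radius [M] and the |x| > M are counted, so
    that no point is counted twice ([counting_lower]).  For the upper bound [j]
    is a coordinate of largest absolute value; then iso_weight k is at most
    d (1 + x^2), which bounds the contribution of every [m] by a constant times
    r w(m).  This makes the contribution of the [m] outside of the cube a
    small multiple of r, while inside the cube the heuristic is exact up to a
    factor 1 + e and an additive constant ([counting_upper]).  Letting [M] tend
    to infinity gives [counting_asymptotic_lower] and
    [counting_asymptotic_upper]. *)

(** * Orthogonality of the exponentials on the torus *)

Section orthogonality.
Context (R : realType).

Lemma probability_integrable_le1 d (T : measurableType d) (P : probability T R)
    (f : T -> R) :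
  measurable_fun setT f -> (forall x, `|f x| <= 1) ->
  P.-integrable setT (EFin \o f).
Proof.
move=> mf f1.
apply: (@le_integrable _ _ _ _ _ measurableT _ (fun=> 1%E)).
- exact/measurable_EFinP.
- by move=> x _ /=; rewrite normr1 lee_fin.
- exact: finite_measure_integrable_cst.
Qed.

Lemma normr_cos_le1 (x : R) : `|cos x| <= 1.
Proof. by rewrite ler_norml cos_geN1 cos_le1. Qed.

Lemma measurable_cos_comp d (T : measurableType d) (f : T -> R) :
  measurable_fun setT f -> measurable_fun setT (fun x => cos (f x)).
Proof.
move=> mf; apply: (@measurableT_comp _ _ _ _ _ _ (@cos R)) => //.
by apply: continuous_measurable_fun; exact: continuous_cos.
Qed.

Lemma measurable_kdot d (k : d.-tuple int) : measurable_fun setT (@kdot R d k).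
Proof.
apply: measurable_sum => i; apply: measurable_funM => //.
exact: measurable_tnth.
Qed.

Lemma periodic_intmul (f : R -> R) (T t : R) (n : int) :
  periodic f T -> f (n%:~R * T + t) = f t.
Proof.
move=> fT; case: n => n.
  by rewrite -pmulrn mulr_natl addrC periodicn.
rewrite NegzE mulrNz -pmulrn mulNr -[LHS](periodicn fT n.+1) mulr_natl.
by rewrite addrAC addNr add0r.
Qed.

(** An arbitrary phase [phi] treats sine and cosine at once.  The integral
    against the uniform distribution is available for nonnegative functions,
    hence the detour through [1 + cos]. *)
Lemma integral_circle_cos (n : int) (phi : R) : n != 0 ->
  (\int[circle_measure R]_x (cos (n%:~R * x + phi))%:E = 0)%E.
Proof.
move=> n0.
have n0' : n%:~R != 0 :> R by rewrite intr_eq0.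
have mc : measurable_fun [set: measurableTypeR R] (fun x => cos (n%:~R * x + phi)).
  by apply: measurable_cos_comp; apply: measurable_funD => //; exact: measurable_funM.
have ic : (circle_measure R).-integrable setT
    (EFin \o (fun x : measurableTypeR R => cos (n%:~R * x + phi))).
  by apply: probability_integrable_le1 => // x; exact: normr_cos_le1.
have i1 : (circle_measure R).-integrable setT (EFin \o (fun=> 1 : R)).
  exact: finite_measure_integrable_cst.
have pi0 := @pi_gt0 R.
have I1 : (\int[circle_measure R]_x (1 + cos (n%:~R * x + phi))%:E = 1)%E.
  rewrite integral_uniform; last 2 first.
  - by apply/measurable_EFinP; exact: measurable_funD.
  - by move=> x; rewrite lee_fin -lerBlDl sub0r cos_geN1.
  pose F (x : R) := x + sin (n%:~R * x + phi) / n%:~R.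
  have dF (x : R) : is_derive x 1 F (1 + cos (n%:~R * x + phi)).
    rewrite /F; apply: is_derive_eq.
    rewrite !scaler0 ?add0r ?addr0.
    by rewrite /GRing.scale /= mulr1; field.
  have cF (x : R) : {for x, continuous F}.
    by apply/differentiable_continuous/derivable1_diffP; case: (dF x).
  rewrite (@continuous_FTC2 _ _ F).
  - have -> : F (2 * pi) = F 0 + 2 * pi.
      rewrite /F mulr0 !add0r.
      rewrite [2 * pi]mulr_natl periodic_intmul; last exact: sinD2pi.
      by rewrite addrC.
    rewrite -EFinB -EFinM subr0 addrAC subrr add0r mulVf//.
    by rewrite gt_eqF// mulr_gt0.
  - by rewrite mulr_gt0.
  - apply: continuous_subspaceT => x.
    apply: cvgD; first exact: cvg_cst.
    apply: (@continuous_comp _ _ _ (fun x : R => n%:~R * x + phi) (@cos R)).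
      by apply: cvgD; [exact: mulrl_continuous|exact: cvg_cst].
    exact: continuous_cos.
  - split.
    + by move=> x _; case: (dF x).
    + exact/cvg_at_right_filter/cF.
    + exact/cvg_at_left_filter/cF.
  - by move=> x _; rewrite derive1E; case: (dF x).
move: I1; under eq_integral do rewrite EFinD.
rewrite integralD //= integral_cst// mul1e.
rewrite (_ : _ setT = 1%E); last exact: (@probability_setT _ _ _ (circle_measure R)).
set I := (\int[_]_x _)%E.
have : I \is a fin_num by apply: (integrable_fin_num _ ic).
by case: I => // r _ [] r1; congr (_%:E); lra.
Qed.

Lemma kdot_cons d (k : d.+1.-tuple int) (x : measurableTypeR R)
    (y : d.-tuple (measurableTypeR R)) :
  kdot k [tuple of x :: y] = (thead k)%:~R * x + kdot [tuple of behead k] y.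
Proof.
rewrite /kdot big_ord_recl; congr (_ + _).
apply: eq_bigr => i _; rewrite tnthS tnth_behead; congr (_%:~R * _).
by congr tnth; apply/val_inj; rewrite /= inordK // ltnS ltn_ord.
Qed.

(** By Fubini one may integrate first over a variable of nonzero frequency and
    treat all other variables as part of the phase; the free phase is what
    makes the induction go through. *)
Lemma integral_torus_cos d (k : d.-tuple int) (phi : R) :
  k != [tuple 0 | _ < d] ->
  (\int[torus_measure R d]_x (cos (kdot k x + phi))%:E = 0)%E.
Proof.
elim: d k phi => [|d IH] k phi k0.
  by case/eqP: k0; rewrite (tuple0 k) (tuple0 [tuple 0 | _ < 0]).
have mc : measurable_fun [set: d.+1.-tuple (measurableTypeR R)]
    (fun x => cos (kdot k x + phi)).
  by apply: measurable_cos_comp; apply: measurable_funD => //; exact: measurable_kdot.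
have mc' : measurable_fun [set: measurableTypeR R * d.-tuple (measurableTypeR R)]
    (fun x => cos (kdot k (tuple_cons x) + phi)).
  apply: measurable_cos_comp; apply: measurable_funD => //.
  by apply: (measurableT_comp (measurable_kdot k)); exact: measurable_tuple_cons.
rewrite /= integral_distribution/=; last 2 first.
- exact/measurable_EFinP.
- apply: (@probability_integrable_le1 _ _ (circle_measure R \x torus_measure R d)%E) => // x.
  exact: normr_cos_le1.
have ic : (circle_measure R \x torus_measure R d)%E.-integrable setT
   (EFin \o (fun x => cos (kdot k (tuple_cons x) + phi))).
  apply: (@probability_integrable_le1 _ _ (circle_measure R \x torus_measure R d)%E) => // x.
  exact: normr_cos_le1.
have [k00|k00] := eqVneq (thead k) 0.
  rewrite -integral12_prod_meas1//; apply: integral0_eq => x _.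
  rewrite /fubini_F /=.
  under eq_integral do rewrite kdot_cons k00 mul0r add0r.
  apply: IH; apply: contra k0 => /eqP k'0; apply/eqP/eq_from_tnth => i.
  rewrite tnth_mktuple; case: (unliftP ord0 i) => [j|] ->; last exact: k00.
  have := congr1 (fun t => tnth t j) k'0.
  rewrite tnth_behead tnth_mktuple => <-; congr tnth.
  by apply/val_inj; rewrite /= inordK // ltnS ltn_ord.
rewrite -integral21_prod_meas1//; apply: integral0_eq => y _.
rewrite /fubini_G /=.
under eq_integral do rewrite kdot_cons -addrA.
exact: (integral_circle_cos (kdot [tuple of behead k] y + phi) k00).
Qed.

End orthogonality.

(** * Trigonometric polynomials in the weighted spaces *)

Section exponentials.
Import complex.ComplexField.Normc.
Local Open Scope complex_scope.
Local Open Scope quotient_scope.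
Context (R : realType) (d : nat).
Local Notation mu := (torus_measure R d).
Local Notation Td := (d.-tuple (measurableTypeR R)).

Lemma integrable_cos_kdot (k : d.-tuple int) (phi : R) :
  mu.-integrable setT (EFin \o (fun x : Td => cos (kdot k x + phi))).
Proof.
apply: (@probability_integrable_le1 _ _ _ mu) => [|x]; last exact: normr_cos_le1.
apply: measurable_cos_comp; apply: measurable_funD => //; exact: measurable_kdot.
Qed.

Lemma sin_cosNpihalf (x : R) : sin x = cos (x - pi / 2).
Proof. by rewrite -sinDpihalf subrK. Qed.

Lemma cintegrable_exp (k : d.-tuple int) :
  cintegrable mu (fun x : Td => expi (kdot k x)).
Proof.
split; rewrite /expi /=.
- rewrite [X in _.-integrable _ X](_ : _ =
    EFin \o (fun x : Td => cos (kdot k x + 0))); first exact: integrable_cos_kdot.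
  by apply/funext => x /=; rewrite addr0.
- rewrite [X in _.-integrable _ X](_ : _ =
    EFin \o (fun x : Td => cos (kdot k x + (- (pi / 2))))); first exact: integrable_cos_kdot.
  by apply/funext => x /=; rewrite sin_cosNpihalf.
Qed.

Lemma cintegral_exp (k : d.-tuple int) :
  cintegral mu (fun x : Td => expi (kdot k x)) = (k == [tuple 0 | _ < d])%:R.
Proof.
have [->|k0] := eqVneq; rewrite /cintegral /Rintegral /expi /=.
  have E x : @kdot R d [tuple 0 | _ < d] x = 0.
    by rewrite /kdot big1// => i _; rewrite tnth_mktuple mul0r.
  under eq_integral do rewrite E cos0.
  under [X in _ +i* fine X]eq_integral do rewrite E sin0.
  rewrite integral_cst// integral0 mul1e.
  by rewrite (_ : _ setT = 1%E)//; exact: (@probability_setT _ _ _ mu).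
have C := @integral_torus_cos R d k 0 k0.
have D := @integral_torus_cos R d k (- (pi / 2)) k0.
under eq_integral do rewrite -[kdot _ _]addr0.
under [X in _ +i* fine X]eq_integral do rewrite sin_cosNpihalf.
by rewrite C D.
Qed.

Lemma expi_kdotM (k l : d.-tuple int) (x : Td) :
  expi (kdot k x) * expi (- kdot l x) =
  expi (kdot [tuple tnth k i - tnth l i | i < d] x).
Proof.
have -> : kdot [tuple tnth k i - tnth l i | i < d] x = kdot k x - kdot l x.
  rewrite /kdot -sumrB; apply: eq_bigr => i _.
  by rewrite tnth_mktuple rmorphB mulrBl.
rewrite /expi cosD sinD.
by apply/eqP; rewrite eq_complex /= (addrC (sin _ * _)) !eqxx.
Qed.

Definition torus_exp (k : d.-tuple int) : L1torus R d :=
  \pi_(L1torus R d) (MkL1fun (asboolT (cintegrable_exp k) : _ \in L1fun_pred mu)).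

(** [fcoef] is computed on a representative chosen by the quotient, which
    agrees with the exponential only almost everywhere. *)
Lemma fcoef_exp (k l : d.-tuple int) : fcoef (torus_exp k) l = (k == l)%:R.
Proof.
rewrite /fcoef /fourier.
transitivity (cintegral mu
    (fun x : Td => expi (kdot [tuple tnth k i - tnth l i | i < d] x))).
  apply: eq_cintegral_ae.
  - apply: cintegrable_expi; apply/asboolP; exact: (valP (repr (torus_exp k))).
  - exact: cintegrable_exp.
  - have /L1_eqP : \pi_(L1torus R d) (repr (torus_exp k)) = torus_exp k by rewrite reprK.
    by apply: filterS => x /= ->; rewrite expi_kdotM.
rewrite cintegral_exp; congr (nat_of_bool _)%:R.
apply/eqP/eqP => [kl|->].
  apply/eq_from_tnth => i; apply/eqP; rewrite -subr_eq0.
  by have := congr1 (fun t => tnth t i) kl; rewrite !tnth_mktuple => ->.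
by apply/eq_from_tnth => i; rewrite !tnth_mktuple subrr.
Qed.

Lemma fcoef0 (k : d.-tuple int) : fcoef (0 : L1torus R d) k = 0.
Proof.
have := fcoefP (-1) (0 : L1torus R d) 0 k; rewrite scaler0 addr0 mulN1r => ->.
by rewrite addNr.
Qed.

Lemma fcoef_sum I (r : seq I) (a : I -> R[i]) (u : I -> L1torus R d) k :
  fcoef (\sum_(i <- r) a i *: u i) k = \sum_(i <- r) a i * fcoef (u i) k.
Proof.
elim: r => [|i r IH]; first by rewrite !big_nil fcoef0.
by rewrite !big_cons fcoefP IH.
Qed.

Lemma fcoefZ a (u : L1torus R d) k : fcoef (a *: u) k = a * fcoef u k.
Proof. by rewrite -[a *: u]addr0 fcoefP fcoef0 addr0. Qed.

Lemma normc_ge0 (z : R[i]) : 0 <= normc z.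
Proof. by case: z => a b; exact: sqrtr_ge0. Qed.

Lemma esumZ_le (T : choiceType) (c : R) (t : T -> R) : 0 <= c -> (forall k, 0 <= t k) ->
  (\esum_(k in [set: T]) (c * t k)%:E <= c%:E * \esum_(k in [set: T]) (t k)%:E)%E.
Proof.
move=> c0 t0; apply: ge_ereal_sup => _ [A [finA _] <-].
rewrite (eq_fsbigr (fun k => c%:E * (t k)%:E)%E); last by move=> k _; rewrite EFinM.
rewrite -ge0_mule_fsumr; last by move=> k; rewrite lee_fin.
by apply: lee_wpmul2l; [rewrite lee_fin|apply: esum_ge; exists A].
Qed.

Lemma esumZ (T : choiceType) (c : R) (t : T -> R) : 0 <= c -> (forall k, 0 <= t k) ->
  (c%:E * (\esum_(k in [set: T]) (t k)%:E) = \esum_(k in [set: T]) (c * t k)%:E)%E.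
Proof.
move=> c0 t0; apply/eqP; rewrite eq_le esumZ_le// andbT.
have [->|c_neq0] := eqVneq c 0.
  by rewrite mul0e esum_ge0// => k _; rewrite mul0r.
have {}c0 : 0 < c by rewrite lt0r c_neq0.
rewrite -lee_pdivlMl//; apply: (@le_trans _ _
    (\esum_(k in [set: T]) (c^-1 * (c * t k))%:E)%E).
  by apply: le_esum => k _; rewrite mulrA mulVf ?mul1r// gt_eqF.
by apply: esumZ_le => [|k]; [rewrite invr_ge0 ltW|rewrite mulr_ge0// ltW].
Qed.

Lemma wsum_ge0 w (u : L1torus R d) : (forall k, 0 <= w k) -> (0 <= wsum w u)%E.
Proof.
by move=> w0; apply: esum_ge0 => k _; rewrite lee_fin mulr_ge0// sqr_ge0.
Qed.

Lemma wsum_exp w k : (forall l, 0 <= w l) -> wsum w (torus_exp k) = (w k)%:E.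
Proof.
move=> w0; rewrite /wsum.
transitivity (\esum_(l in [set k]) (w l)%:E); last by rewrite esum_set1// lee_fin.
rewrite [RHS]esum_mkcond; apply: eq_esum => l _; rewrite fcoef_exp eq_sym.
have -> : (l \in [set k]) = (l == k) by apply/idP/eqP; rewrite in_setE.
have [_|_] := eqVneq; first by rewrite normc1 expr1n mulr1.
by rewrite normc0 expr0n mulr0.
Qed.

Lemma wsum_fine w (u : L1torus R d) : (forall k, 0 <= w k) ->
  u \in wsum_pred w -> wsum w u = (fine (wsum w u))%:E.
Proof.
by move=> w0; rewrite inE => uw; rewrite fineK// ge0_fin_numE// wsum_ge0.
Qed.

Lemma wsumZ_le w c (u : L1torus R d) : (forall k, 0 <= w k) ->
  (wsum w (c *: u) <= (normc c ^+ 2)%:E * wsum w u)%E.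
Proof.
move=> w0; apply: le_trans (esumZ_le _ _).
- by apply: le_esum => k _; rewrite fcoefZ normcM exprMn mulrCA.
- exact: sqr_ge0.
- by move=> k; rewrite mulr_ge0// sqr_ge0.
Qed.

End exponentials.

(** * Approximation numbers of the embedding and level sets of the weights *)

Section approximation.
Import complex.ComplexField.Normc.
Local Open Scope complex_scope.
Context (R : realType) (d : nat) (s : R).

Lemma exp_in_Hmix (k : d.-tuple int) : torus_exp R k \in @Hmix_pred R d s.
Proof. by rewrite inE wsum_exp ?ltry//; exact: mix_weight_ge0. Qed.

Lemma exp_in_H1iso (k : d.-tuple int) : torus_exp R k \in @H1iso_pred R d.
Proof. by rewrite inE wsum_exp ?ltry//; exact: iso_weight_ge0. Qed.

Definition mix_exp k : Hmix d s := MkHmix (exp_in_Hmix k).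
Definition iso_exp k : H1iso R d := MkH1iso (exp_in_H1iso k).

Lemma fcoef_sum_mix_exp I (r : seq I) (a : I -> R[i]) (f : I -> d.-tuple int) l :
  fcoef (\sum_(i <- r) a i *: mix_exp (f i) : Hmix d s) l =
  \sum_(i <- r) a i * (f i == l)%:R.
Proof.
rewrite (_ : Hmix_val _ = \sum_(i <- r) a i *: torus_exp R (f i)).
  by rewrite fcoef_sum; apply: eq_bigr => i _; rewrite fcoef_exp.
elim: r => [|i r IH]; first by rewrite !big_nil.
by rewrite !big_cons -IH.
Qed.

Lemma fcoef_sum_iso_exp I (r : seq I) (a : I -> R[i]) (f : I -> d.-tuple int) l :
  fcoef (\sum_(i <- r) a i *: iso_exp (f i) : H1iso R d) l =
  \sum_(i <- r) a i * (f i == l)%:R.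
Proof.
rewrite (_ : H1iso_val _ = \sum_(i <- r) a i *: torus_exp R (f i)).
  by rewrite fcoef_sum; apply: eq_bigr => i _; rewrite fcoef_exp.
elim: r => [|i r IH]; first by rewrite !big_nil.
by rewrite !big_cons -IH.
Qed.

Definition fourier_proj (F : seq (d.-tuple int)) (u : Hmix d s) : H1iso R d :=
  \sum_(k <- undup F) fcoef u k *: iso_exp k.

Lemma fourier_proj_is_linear F : linear (fourier_proj F).
Proof.
move=> a u v; rewrite /fourier_proj scaler_sumr -big_split /=.
by apply: eq_bigr => k _; rewrite fcoefP scalerDl scalerA.
Qed.

HB.instance Definition _ F := GRing.isLinear.Build R[i] (Hmix d s) (H1iso R d) _
  (fourier_proj F) (fourier_proj_is_linear F).

Lemma fcoef_fourier_proj F u l :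
  fcoef (fourier_proj F u) l = if l \in F then fcoef u l else 0.
Proof.
rewrite (fcoef_sum_iso_exp _ _ id) -mem_undup; case: ifPn => lF.
  rewrite (bigD1_seq l) ?undup_uniq//= eqxx mulr1 big1 ?addr0// => k kl.
  by rewrite (negbTE kl) mulr0.
rewrite big1_seq// => k /= kF; case: eqVneq => [kl|]; last by rewrite mulr0.
by rewrite -kl kF in lF.
Qed.

Lemma Hmix_norm_le1 (u : Hmix d s) :
  Hmix_norm u <= 1 -> (wsum (mix_weight s) u <= 1)%E.
Proof.
have w0 := @mix_weight_ge0 R d s.
rewrite (wsum_fine w0 (valP u)) /Hmix_norm lee_fin.
by rewrite -[X in _ <= X -> _]sqrtr1 ler_sqrt.
Qed.

Lemma H1iso_norm_le c (v : H1iso R d) : 0 <= c ->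
  (wsum (@iso_weight R d) v <= (c ^+ 2)%:E)%E -> H1iso_norm v <= c.
Proof.
have w0 := @iso_weight_ge0 R d.
move=> c0; rewrite (wsum_fine w0 (valP v)) /H1iso_norm lee_fin => h.
by rewrite -(ger0_norm c0) -sqrtr_sqr ler_wsqrtr.
Qed.

Lemma H1iso_norm_ge c (v : H1iso R d) : 0 <= c ->
  ((c ^+ 2)%:E <= wsum (@iso_weight R d) v)%E -> c <= H1iso_norm v.
Proof.
have w0 := @iso_weight_ge0 R d.
move=> c0; rewrite (wsum_fine w0 (valP v)) /H1iso_norm lee_fin => h.
by rewrite -{1}(ger0_norm c0) -sqrtr_sqr ler_wsqrtr.
Qed.

Context (s1 : 1 < s).

(** The remainder of the Fourier projection only has coefficients outside of
    [F], where the ratio of the two weights is at most [c ^+ 2]. *)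
Lemma approx_number_le (F : seq (d.-tuple int)) (c : R) (n : nat) :
  0 <= c -> (size F < n)%N ->
  (forall k, k \notin F -> iso_weight R k <= c ^+ 2 * mix_weight s k) ->
  (approx_number (@Hmix_norm R d s) (@H1iso_norm R d) (embed (d := d) s1) n
    <= c%:E)%E.
Proof.
move=> c0 Fn Fc.
have w0 := @mix_weight_ge0 R d s; have v0 := @iso_weight_ge0 R d.
have n0 (z : R[i]) : 0 <= normc z ^+ 2 by exact: sqr_ge0.
apply: (@le_trans _ _ (opnorm (@Hmix_norm R d s) (@H1iso_norm R d)
    (fun u => embed s1 u - fourier_proj F u))).
  apply: ereal_inf_lbound; exists (fourier_proj F) => //; split.
    apply: (@le_lt_trans _ _ 1%E); last exact: ltry.
    apply: ge_ereal_sup => _ [u /Hmix_norm_le1 u1 <-]; rewrite lee_fin.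
    apply: H1iso_norm_le => //; rewrite expr1n; apply: le_trans u1.
    apply: le_esum => k _; rewrite lee_fin fcoef_fourier_proj.
    case: ifP => _; last by rewrite normc0 expr0n mulr0 mulr_ge0.
    by rewrite ler_wpM2r// iso_le_mix_weight// ltW.
  exists (size (undup F)), (fun i => iso_exp (tnth (in_tuple (undup F)) i)); split.
    exact: leq_ltn_trans (size_undup F) Fn.
  move=> u; exists (fun i => fcoef u (tnth (in_tuple (undup F)) i)).
  by rewrite -(big_tnth _ _ (undup F) xpredT (fun k => fcoef u k *: iso_exp k)).
apply: ge_ereal_sup => _ [u /Hmix_norm_le1 u1 <-]; rewrite lee_fin.
apply: H1iso_norm_le => //.
apply: (@le_trans _ _ ((c ^+ 2)%:E * wsum (mix_weight s) u)%E); last first.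
  by rewrite -[leRHS]mule1 lee_wpmul2l// lee_fin sqr_ge0.
apply: le_trans (esumZ_le (sqr_ge0 c) _) => [|k]; last by rewrite mulr_ge0.
apply: le_esum => k _; rewrite lee_fin.
have E : H1iso_val (embed s1 u - fourier_proj F u) =
    -1 *: H1iso_val (fourier_proj F u) + Hmix_val u by rewrite scaleN1r addrC.
rewrite E fcoefP mulN1r addrC {E}.
rewrite fcoef_fourier_proj; case: ifPn => [_|kF].
  by rewrite subrr normc0 expr0n mulr0 mulr_ge0 // mulr_ge0.
by rewrite subr0 mulrA ler_wpM2r// Fc.
Qed.

(** The matrix of [A] on the [n] exponentials has fewer than [n] columns, so
    some nonzero combination [u] of them is sent to 0.  The error of [A] on [u]
    is the [H1] norm of [u] itself, at least [c] times its mixed norm. *)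
Lemma le_approx_number (n : nat) (f : 'I_n -> d.-tuple int) (c : R) :
  0 <= c -> injective f ->
  (forall i, c ^+ 2 * mix_weight s (f i) <= iso_weight R (f i)) ->
  (c%:E <= approx_number (@Hmix_norm R d s) (@H1iso_norm R d) (embed (d := d) s1) n)%E.
Proof.
move=> c0 finj fc.
have w0 := @mix_weight_ge0 R d s; have v0 := @iso_weight_ge0 R d.
have n0 (z : R[i]) : 0 <= normc z ^+ 2 by exact: sqr_ge0.
apply: le_ereal_inf_tmp => _ [A [_ [m [y [mn Ay]]]] <-].
have /choice [C CP] : forall i, exists a : 'I_m -> R[i],
    A (mix_exp (f i)) = \sum_(j < m) a j *: y j by move=> i; exact: Ay.
pose M : 'M[R[i]]_(n, m) := \matrix_(i, j) C i j.
have : kermx M != 0.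
  rewrite kermx_eq0 /row_free neq_ltn; apply/orP; left.
  exact: leq_ltn_trans (rank_leq_col M) mn.
case/rowV0Pn => v /sub_kermxP vM v_neq0.
pose u : Hmix d s := \sum_(i < n) v 0 i *: mix_exp (f i).
have Au : A u = 0.
  rewrite /u linear_sum /=.
  under eq_bigr do rewrite linearZ /= CP scaler_sumr.
  rewrite exchange_big /= big1// => j _.
  under eq_bigr do rewrite scalerA.
  rewrite -scaler_suml (_ : \sum_(i < n) _ = (v *m M) 0 j); last first.
    by rewrite mxE; apply: eq_bigr => i _; rewrite mxE.
  by rewrite vM mxE scale0r.
have ul l : (forall i, f i != l) -> fcoef u l = 0.
  move=> fl; rewrite fcoef_sum_mix_exp big1// => i _.
  by rewrite (negbTE (fl i)) mulr0.
have uf i : fcoef u (f i) = v 0 i.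
  rewrite fcoef_sum_mix_exp (bigD1 i)//= eqxx mulr1 big1 ?addr0// => j ji.
  by rewrite (inj_eq finj) (negbTE ji) mulr0.
have fmix l : 0 < mix_weight s l.
  apply: (@lt_le_trans _ _ (iso_weight R l)); last by rewrite iso_le_mix_weight ?ltW.
  by apply: (@lt_le_trans _ _ 1) => //; rewrite lerDl sumr_ge0// => j _; exact: sqr_ge0.
have uE := wsum_fine w0 (valP u).
set N := fine _ in uE.
have N0 : 0 < N.
  have [i vi] : exists i, v 0 i != 0.
    apply/existsP; apply: contraNT v_neq0; rewrite negb_exists => /forallP h.
    by apply/eqP/rowP => i; rewrite mxE; apply/eqP; move: (h i); rewrite negbK.
  rewrite -lte_fin -uE; apply: (@lt_le_trans _ _
      (mix_weight s (f i) * normc (fcoef u (f i)) ^+ 2)%:E); last first.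
    apply: esum_ge; exists [set f i]; last by rewrite fsbig_set1.
    by split.
  rewrite lte_fin mulr_gt0// uf exprn_gt0// lt0r normc_ge0 andbT.
  by apply: contraNN vi => /eqP/eq0_normc ->.
(* b *: u has mixed norm 1. *)
pose b : R[i] := (Num.sqrt N)^-1%:C.
have nb : normc b ^+ 2 = N^-1.
  rewrite /b /normc /= expr0n addr0 sqr_sqrtr ?sqr_ge0//.
  by rewrite exprVn sqr_sqrtr// ltW.
apply: (@le_trans _ _ (H1iso_norm (embed s1 (b *: u) - A (b *: u)))%:E); last first.
  apply: ereal_sup_ubound; exists (b *: u) => //=.
  rewrite /Hmix_norm -(sqrtr1 R) ler_wsqrtr//.
  rewrite -lee_fin -(wsum_fine w0 (valP (b *: u))).
  apply: le_trans (wsumZ_le _ _ w0) _.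
  by rewrite nb uE -EFinM mulVf// gt_eqF.
have -> : A (b *: u) = 0 by rewrite linearZ /= Au scaler0.
rewrite subr0 lee_fin; apply: H1iso_norm_ge => //.
have -> : ((c ^+ 2)%:E = (c ^+ 2 * N^-1)%:E * wsum (mix_weight s) u)%E.
  by rewrite uE -EFinM -mulrA mulVf ?mulr1// gt_eqF.
have cN0 : 0 <= c ^+ 2 * N^-1 by rewrite mulr_ge0 ?sqr_ge0// invr_ge0 ltW.
have -> : ((c ^+ 2 * N^-1)%:E * wsum (mix_weight s) u)%E =
    (\esum_(k in [set: d.-tuple int])
      (c ^+ 2 * N^-1 * (mix_weight s k * normc (fcoef u k) ^+ 2))%:E)%E.
  by rewrite esumZ// => k; rewrite mulr_ge0.
apply: le_esum => k _; rewrite lee_fin.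
have -> : fcoef (embed s1 (b *: u)) k = b * fcoef u k by exact: fcoefZ.
rewrite normcM exprMn nb.
have [[i <-]|kf] := pselect (exists i, f i = k).
  rewrite [leLHS](_ : _ = N^-1 * normc (fcoef u (f i)) ^+ 2 *
      (c ^+ 2 * mix_weight s (f i))); last by ring.
  rewrite [leRHS](_ : _ = N^-1 * normc (fcoef u (f i)) ^+ 2 *
      iso_weight R (f i)); last by ring.
  by rewrite ler_wpM2l// mulr_ge0// invr_ge0 ltW.
have -> : fcoef u k = 0 by apply: ul => i; apply/eqP => fi; apply: kf; exists i.
by rewrite normc0 expr0n !mulr0.
Qed.

End approximation.

(** * Integer points near the coordinate axes *)

(** The finite type ['I_B.*2.+1] enumerates the integers of absolute value at
    most [B]. *)
Definition centered (B : nat) (i : 'I_B.*2.+1) : int := i%:Z - B%:Z.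

Lemma centered_inj B : injective (@centered B).
Proof. by move=> i j /addIr [] /val_inj. Qed.

Lemma absz_centered B (i : 'I_B.*2.+1) : (`|centered i| <= B)%N.
Proof. rewrite /centered; have := ltn_ord i; lia. Qed.

Lemma centered_surj B (x : int) : (`|x| <= B)%N -> exists i : 'I_B.*2.+1, centered i = x.
Proof.
move=> xB; have h : (`|(x + B%:Z)%R| < B.*2.+1)%N by lia.
exists (Ordinal h); rewrite /centered /=; lia.
Qed.

Lemma sum_centered (V : nmodType) (F : int -> V) B :
  \sum_(i < B.*2.+1) F (centered i) = F 0 + \sum_(1 <= k < B.+1) (F k%:Z + F (- k%:Z)).
Proof.
rewrite -(big_mkord xpredT (fun i => F (i%:Z - B%:Z))).
elim: B => [|B IH].
  by rewrite big_nat1 big_geq// !addr0.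
rewrite [in RHS]big_nat_recr//= addrA -IH doubleS big_nat_recl// big_nat_recr//=.
rewrite (eq_bigr (fun i : nat => F (i%:Z - B%:Z))); last by move=> i _; congr F; lia.
by rewrite addrCA; congr (_ + _); rewrite addrC; congr (F _ + F _); lia.
Qed.

Definition insert_coord n (j : 'I_n.+1) (x : int) (m : 'I_n -> int) : n.+1.-tuple int :=
  [tuple if unlift j i is Some i' then m i' else x | i < n.+1].

Lemma tnth_insert_coord n (j : 'I_n.+1) x m : tnth (insert_coord j x m) j = x.
Proof. by rewrite tnth_mktuple unlift_none. Qed.

Lemma tnth_insert_coord_lift n (j : 'I_n.+1) x m i :
  tnth (insert_coord j x m) (lift j i) = m i.
Proof. by rewrite tnth_mktuple liftK. Qed.

Lemma insert_tnth n (j : 'I_n.+1) (k : n.+1.-tuple int) m :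
  (forall i, m i = tnth k (lift j i)) -> insert_coord j (tnth k j) m = k.
Proof.
move=> mk; apply/eq_from_tnth => i; case: (unliftP j i) => [i'|] ->.
  by rewrite tnth_insert_coord_lift.
by rewrite tnth_insert_coord.
Qed.

Definition signed_range (l n : nat) : seq int :=
  [seq i%:Z | i <- iota l n] ++ [seq - i%:Z | i <- iota l n].

Lemma size_signed_range l n : size (signed_range l n) = n.*2.
Proof. by rewrite size_cat !size_map size_iota addnn. Qed.

Lemma mem_signed_range l n x : (x \in signed_range l n) = (l <= `|x| < l + n)%N.
Proof.
rewrite mem_cat -mem_iota; apply/orP/idP => [[] /mapP[i il ->]|xl].
- by rewrite absz_nat.
- by rewrite abszN absz_nat.
have [x0|x0] := leP 0 x; [left|right]; apply/mapP; exists `|x|%N => //; lia.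
Qed.

Lemma signed_range_uniq l n : (0 < l)%N -> uniq (signed_range l n).
Proof.
move=> l0; rewrite cat_uniq !map_inj_uniq ?iota_uniq ?andbT/=.
- apply/hasPn => x /mapP[j]; rewrite mem_iota => /andP[lj _] ->.
  by apply/mapP => -[j' _]; lia.
- by move=> i j; lia.
- by move=> i j; lia.
Qed.

Definition axis_point n B (p : 'I_n.+1 * {ffun 'I_n -> 'I_B.*2.+1}) (x : int) :=
  insert_coord p.1 x (fun i => centered (p.2 i)).

(** One coordinate [x], ranging over a list that depends on the other
    coordinates, is inserted at every possible position into every point [m] of
    a cube.  Both counting bounds use sets of this shape. *)
Definition axis_boxes n B (y : {ffun 'I_n -> 'I_B.*2.+1} -> seq int) :
    seq (n.+1.-tuple int) :=
  [seq axis_point p x | p <- enum predT, x <- y p.2].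

Lemma axis_boxesP n B (y : {ffun 'I_n -> 'I_B.*2.+1} -> seq int) k :
  reflect (exists j m x, x \in y m /\ k = insert_coord j x (fun i => centered (m i)))
    (k \in axis_boxes y).
Proof.
apply: (iffP allpairsPdep) => [[[j m] [x [_ xy ->]]]|[j [m [x [xm ->]]]]].
  by exists j, m, x.
by exists (j, m), x; rewrite mem_enum.
Qed.

Lemma size_axis_boxes n B (y : {ffun 'I_n -> 'I_B.*2.+1} -> seq int) :
  size (axis_boxes y) = (n.+1 * \sum_m size (y m))%N.
Proof.
rewrite size_allpairs_dep sumnE big_map big_enum /=.
by rewrite -(pair_bigA _ (fun _ m => size (y m))) /= sum_nat_const card_ord.
Qed.

(** If the inserted coordinate always exceeds the radius of the cube, its
    position and the point [m] can be read off from the result. *)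
Lemma axis_boxes_uniq n B (y : {ffun 'I_n -> 'I_B.*2.+1} -> seq int) :
  (forall m, uniq (y m)) -> (forall m x, x \in y m -> (B < `|x|)%N) ->
  uniq (axis_boxes y).
Proof.
move=> yu yB; apply: allpairs_uniq_dep => /=.
- exact: enum_uniq.
- by move=> p _; exact: yu.
move=> _ _ /allpairsPdep [[j m] [x [_ /= xm ->]]] /allpairsPdep [[j' m'] [x' [_ /= xm' ->]]].
rewrite /axis_point /= => E.
have jj : j = j'.
  apply/eqP; apply: contraTT (yB _ _ xm) => jj'.
  rewrite -(tnth_insert_coord j x (fun i => centered (m i))) E.
  case: (unliftP j' j) jj' => [i ->|->]; last by rewrite eqxx.
  by rewrite tnth_insert_coord_lift -leqNgt absz_centered.
move: E xm'; rewrite -{j'}jj => E xm'.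
have xx : x = x' by have := congr1 (fun t => tnth t j) E; rewrite !tnth_insert_coord.
have mm : m = m'.
  apply/ffunP => i; apply: centered_inj.
  by have := congr1 (fun t => tnth t (lift j i)) E; rewrite !tnth_insert_coord_lift.
by rewrite xx mm.
Qed.

Lemma sum_centered_restrict (R : nmodType) (f : int -> R) M B : (M <= B)%N ->
  \sum_(i < B.*2.+1 | (`|centered i| <= M)%N) f (centered i) =
  \sum_(i < M.*2.+1) f (centered i).
Proof.
move=> MB; rewrite big_mkcond /=.
rewrite (sum_centered (fun x => if (`|x| <= M)%N then f x else 0)) sum_centered.
rewrite absz0 /=; congr (_ + _).
rewrite (big_cat_nat (n := M.+1))//= [X in _ + X]big1_seq ?addr0; last first.
  move=> k; rewrite mem_index_iota => /andP[_ /andP[Mk _]].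
  by rewrite abszN absz_nat leqNgt Mk addr0.
rewrite !big_nat; apply: eq_bigr => k /andP[_ kM].
by rewrite abszN absz_nat -ltnS kM.
Qed.

Definition in_box n M B (m : {ffun 'I_n -> 'I_B.*2.+1}) : bool :=
  [forall i, (`|centered (m i)| <= M)%N].

(** This is used twice: with the weight of an axis it factors the sum of the
    products over a cube, and with [f] constant it counts the points. *)
Lemma sum_in_box (R : comNzRingType) (f : int -> R) n M B : (M <= B)%N ->
  \sum_(m : {ffun 'I_n -> 'I_B.*2.+1} | in_box M m) \prod_(i < n) f (centered (m i)) =
  (\sum_(i < M.*2.+1) f (centered i)) ^+ n.
Proof.
move=> MB; rewrite -(sum_centered_restrict f MB) -[in RHS](card_ord n) -prodr_const.
rewrite bigA_distr_big; apply: eq_bigl => m.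
by apply/forallP/ffun_onP.
Qed.

Lemma in_box_full n B (m : {ffun 'I_n -> 'I_B.*2.+1}) : in_box B m.
Proof. by apply/forallP => i; exact: absz_centered. Qed.

Lemma card_in_box n M B : (M <= B)%N ->
  #|[pred m : {ffun 'I_n -> 'I_B.*2.+1} | in_box M m]| = (M.*2.+1 ^ n)%N.
Proof.
move=> MB; apply/eqP; rewrite -(eqr_nat int) natrX; apply/eqP.
have := @sum_in_box int (fun=> 1) n M B MB.
have -> : \sum_(i < M.*2.+1) 1 = (M.*2.+1)%:R :> int by rewrite sumr_const card_ord.
move=> <-; rewrite -sumr_const.
by apply: eq_bigr => m _; rewrite big1.
Qed.

(** * Counting the integer points below a level *)

Section counting.
Context (R : realType) (a : R).
Context (a0 : 0 < a).

Definition bracket (x : int) : R := 1 + `|x%:~R : R| ^+ 2.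
(** The exponent [a + 2^-1] is s / (2 (s - 1)) for a = 1 / (2 (s - 1)). *)
Definition axis_weight (x : int) : R := (bracket x `^ (a + 2^-1))^-1.
Definition box_sum (B : nat) : R := \sum_(i < B.*2.+1) axis_weight (centered i).

Lemma bracket_ge1 x : 1 <= bracket x.
Proof. by rewrite lerDl sqr_ge0. Qed.

Lemma bracket_gt0 x : 0 < bracket x.
Proof. exact: lt_le_trans (bracket_ge1 x). Qed.

Lemma bracket_pow_gt0 x c : 0 < bracket x `^ c.
Proof. by rewrite powR_gt0 // bracket_gt0. Qed.

Lemma axis_weight_gt0 x : 0 < axis_weight x.
Proof. by rewrite invr_gt0 bracket_pow_gt0. Qed.

Lemma axis_weight_le1 x : axis_weight x <= 1.
Proof.
rewrite invf_le1 ?bracket_pow_gt0//.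
suff : 1 `^ (a + 2^-1) <= bracket x `^ (a + 2^-1) by rewrite powR1.
rewrite ge0_ler_powR ?nnegrE ?bracket_ge1//; last exact: ltW (bracket_gt0 x).
by rewrite addr_ge0 ?ltW// invr_gt0.
Qed.

Lemma axis_weight0 : axis_weight 0 = 1.
Proof. by rewrite /axis_weight /bracket normr0 expr0n addr0 powR1 invr1. Qed.

Lemma axis_weightN x : axis_weight (- x) = axis_weight x.
Proof. by rewrite /axis_weight /bracket rmorphN normrN. Qed.

Lemma box_sumE B : box_sum B = 1 + 2 * \sum_(1 <= k < B.+1) axis_weight k%:Z.
Proof.
rewrite /box_sum sum_centered axis_weight0; congr (_ + _).
rewrite big_distrr /=; apply: eq_bigr => k _.
by rewrite axis_weightN mulr_natl.
Qed.

Context (n : nat).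

Definition box_weight B (m : {ffun 'I_n -> 'I_B.*2.+1}) : R :=
  \prod_(i < n) axis_weight (centered (m i)).

Lemma sum_box_weight M B : (M <= B)%N ->
  \sum_(m : {ffun 'I_n -> 'I_B.*2.+1} | in_box M m) box_weight m = box_sum M ^+ n.
Proof. exact: sum_in_box. Qed.

Lemma sum_box_weightT B :
  \sum_(m : {ffun 'I_n -> 'I_B.*2.+1}) box_weight m = box_sum B ^+ n.
Proof.
by rewrite -(sum_box_weight (leqnn B)); apply: eq_bigl => m; rewrite in_box_full.
Qed.

(** This is [mix_weight s k] to the power 1 / (2 (s - 1)).  Raising the level
    condition to this power makes it linear in the largest coordinate. *)
Definition tensor_weight (k : n.+1.-tuple int) : R :=
  \prod_(i < n.+1) bracket (tnth k i) `^ (a + 2^-1).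

Lemma tensor_weight_insert B j x (m : {ffun 'I_n -> 'I_B.*2.+1}) :
  tensor_weight (insert_coord j x (fun i => centered (m i))) =
  bracket x `^ a * Num.sqrt (bracket x) / box_weight m.
Proof.
rewrite /tensor_weight (bigD1_ord j)//= tnth_insert_coord.
congr (_ * _).
  rewrite powRD; last by apply/implyP => _; rewrite gt_eqF ?bracket_gt0.
  by rewrite powR12_sqrt// ltW// bracket_gt0.
rewrite /box_weight -prodfV; apply: eq_bigr => i _.
by rewrite tnth_insert_coord_lift /axis_weight invrK.
Qed.

Lemma box_weight_gt0 B (m : {ffun 'I_n -> 'I_B.*2.+1}) : 0 < box_weight m.
Proof. by apply: prodr_gt0 => i _; exact: axis_weight_gt0. Qed.

Lemma box_weight_le1 B (m : {ffun 'I_n -> 'I_B.*2.+1}) : box_weight m <= 1.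
Proof.
by apply: prodr_ile1 => i _; rewrite axis_weight_le1 ltW ?axis_weight_gt0.
Qed.

Lemma iso_weight_insert B j x (m : {ffun 'I_n -> 'I_B.*2.+1}) :
  iso_weight R (insert_coord j x (fun i => centered (m i))) =
  bracket x + \sum_(i < n) `|(centered (m i))%:~R : R| ^+ 2.
Proof.
rewrite /iso_weight (bigD1_ord j)//= tnth_insert_coord addrA; congr (_ + _).
by apply: eq_bigr => i _; rewrite tnth_insert_coord_lift.
Qed.

Lemma intr_absz (x : int) : `|x%:~R : R| = (`|x|%N)%:R.
Proof. by rewrite -intr_norm -abszE -pmulrn. Qed.

Lemma sqrt_bracket_le x : Num.sqrt (bracket x) <= 1 + (`|x|%N)%:R.
Proof.
rewrite -intr_absz -[leRHS]ger0_norm ?addr_ge0// -sqrtr_sqr ler_wsqrtr// /bracket.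
rewrite -subr_ge0 (_ : _ - _ = 2 * `|x%:~R|); last by ring.
by rewrite mulr_ge0.
Qed.

Lemma sqrt_bracket_ge x : (`|x|%N)%:R <= Num.sqrt (bracket x).
Proof.
rewrite -intr_absz -[leLHS]normr_id -sqrtr_sqr ler_wsqrtr// /bracket.
by rewrite lerDr.
Qed.

Lemma sqrt_bracket_ge1 x : 1 <= Num.sqrt (bracket x).
Proof. by rewrite -[leLHS]sqrtr1 ler_wsqrtr// bracket_ge1. Qed.

(** For a coordinate [x] inserted next to [m] one has [bracket x <= iso_weight],
    so 1 + |x| <= r w(m) is enough for the level condition.  Taking all
    |x| > M with this property, the loss for each [m] is at most M + 2. *)
Lemma counting_lower (M : nat) (r : R) : exists F : seq (n.+1.-tuple int),
  [/\ uniq F, forall k, k \in F -> tensor_weight k <= r * iso_weight R k `^ a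
    & n.+1%:R * (2 * (r * box_sum M ^+ n - (M.+2 * M.*2.+1 ^ n)%:R)) <= (size F)%:R].
Proof.
pose y (m : {ffun 'I_n -> 'I_M.*2.+1}) :=
  signed_range M.+1 (Num.truncn (r * box_weight m - M.+1%:R)).
exists (axis_boxes y); split.
- apply: axis_boxes_uniq => [m|m x]; first exact: signed_range_uniq.
  by rewrite mem_signed_range => /andP[].
- move=> _ /axis_boxesP [j [m [x [xm ->]]]].
  rewrite tensor_weight_insert iso_weight_insert.
  have wm := box_weight_gt0 m; have qx := bracket_gt0 x.
  have xr : 1 + (`|x|%N)%:R <= r * box_weight m.
    move: xm; rewrite mem_signed_range; set t := _ - _ => /andP[Mx xt].
    have t0 : 0 <= t.
      apply: (le_trans ler01); rewrite -truncn_gt0 lt0n; apply/eqP => t0.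
      by move: xt; rewrite t0 addn0 ltnNge Mx.
    apply: le_trans (_ : (M.+1 + Num.truncn t)%:R <= _).
      by rewrite -(natrD _ 1) ler_nat add1n.
    by rewrite natrD -lerBrDl truncn_le.
  have r0 : 0 <= r.
    by rewrite -(pmulr_lge0 _ wm); apply: le_trans xr; rewrite addr_ge0.
  rewrite ler_pdivrMr// mulrAC mulrC ler_pM ?powR_ge0 ?sqrtr_ge0//.
    exact: le_trans (sqrt_bracket_le x) xr.
  have S0 : 0 <= \sum_(i < n) `|(centered (m i))%:~R : R| ^+ 2.
    by apply: sumr_ge0 => i _; exact: sqr_ge0.
  by rewrite ge0_ler_powR ?nnegrE ?addr_ge0 ?lerDl ?(ltW a0) ?(ltW qx).
- rewrite size_axis_boxes [leRHS]natrM ler_wpM2l// natr_sum.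
  rewrite -sum_box_weightT natrM natrX -[X in _ ^+ X](card_ord n) -prodr_const.
  have -> : \prod_(i in 'I_n) (M.*2.+1)%:R =
      \sum_(m : {ffun 'I_n -> 'I_M.*2.+1}) 1 :> R.
    by rewrite prodr_const sumr_const card_ffun !card_ord natrX.
  rewrite 2!mulr_sumr -sumrB mulr_sumr ler_sum// => m _.
  rewrite size_signed_range -muln2 natrM mulrC ler_wpM2r// mulr1.
  set t := (X in Num.truncn X); have := truncnS_gt t; set T := Num.truncn t.
  rewrite /t -!natr1; lra.
Qed.
(** A comparison of [iso_weight] with [bracket x] turns the level condition into
    a bound on [x] that is proportional to the weight of the other
    coordinates. *)
Lemma tensor_weight_axis_bound B j x (m : {ffun 'I_n -> 'I_B.*2.+1}) (r t : R) :
  0 <= r -> 0 <= t ->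
  iso_weight R (insert_coord j x (fun i => centered (m i))) <= t * bracket x ->
  tensor_weight (insert_coord j x (fun i => centered (m i))) <=
    r * iso_weight R (insert_coord j x (fun i => centered (m i))) `^ a ->
  Num.sqrt (bracket x) <= r * t `^ a * box_weight m.
Proof.
move=> r0 t0 isot; rewrite tensor_weight_insert => h.
have qx := bracket_gt0 x.
rewrite -ler_pdivrMr ?box_weight_gt0// -(ler_pM2l (bracket_pow_gt0 x a)).
rewrite mulrA; apply: le_trans h _.
rewrite mulrCA ler_wpM2l// mulrC -powRM ?(ltW qx)//.
by rewrite ge0_ler_powR ?nnegrE ?(ltW a0) ?mulr_ge0 ?(ltW qx)// iso_weight_ge0.
Qed.

Lemma iso_weight_insert_max B j x (m : {ffun 'I_n -> 'I_B.*2.+1}) :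
  (forall i, (`|centered (m i)| <= `|x|)%N) ->
  iso_weight R (insert_coord j x (fun i => centered (m i))) <= n.+1%:R * bracket x.
Proof.
move=> mx; rewrite iso_weight_insert -natr1 mulrDl mul1r addrC lerD2r.
rewrite -[X in X%:R](card_ord n) mulr_natl -sumr_const ler_sum// => i _.
rewrite !intr_absz /bracket; apply: (@le_trans _ _ (`|x|%N%:R ^+ 2)).
  by rewrite lerXn2r ?nnegrE// ler_nat.
by rewrite intr_absz lerDr.
Qed.

Lemma iso_weight_insert_box M B j x (m : {ffun 'I_n -> 'I_B.*2.+1}) :
  in_box M m ->
  iso_weight R (insert_coord j x (fun i => centered (m i)))
    <= bracket x + (n * M ^ 2)%:R.
Proof.
move=> /forallP mM; rewrite iso_weight_insert lerD2l.
rewrite natrM -[X in X%:R * _](card_ord n) mulr_natl -sumr_const ler_sum// => i _.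
by rewrite intr_absz natrX lerXn2r ?nnegrE// ler_nat.
Qed.

(** The coordinate of largest absolute value is at most r (n+1)^a by
    [tensor_weight_axis_bound], so that the other ones fit into any cube of at
    least this radius. *)
Lemma max_coord_bounds (k : n.+1.-tuple int) (r : R) : 0 <= r ->
  tensor_weight k <= r * iso_weight R k `^ a ->
  exists j, forall B, r * n.+1%:R `^ a <= B%:R ->
  exists m : {ffun 'I_n -> 'I_B.*2.+1},
    k = insert_coord j (tnth k j) (fun i => centered (m i)) /\
    forall i, (`|centered (m i)| <= `|tnth k j|)%N.
Proof.
move=> r0 kr.
have [j _ jmax] := @arg_maxnP _ ord0 xpredT (fun i => `|tnth k i|%N) isT.
pose x := tnth k j.
have box B : (`|x| <= B)%N -> exists m : {ffun 'I_n -> 'I_B.*2.+1},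
    k = insert_coord j x (fun i => centered (m i)) /\
    forall i, (`|centered (m i)| <= `|x|)%N.
  move=> xB.
  have /choice [m mE] : forall i : 'I_n, exists c : 'I_B.*2.+1,
      centered c = tnth k (lift j i).
    by move=> i; apply: centered_surj; apply: leq_trans xB; exact: jmax.
  exists (finfun m); split => [|i]; last by rewrite ffunE mE; exact: jmax.
  by rewrite insert_tnth// => i; rewrite ffunE mE.
exists j => B rB; apply: (box B); rewrite -(ler_nat R); apply: le_trans rB.
(* The cube of radius |x| itself serves to bound x. *)
have [m [kE mx]] := box _ (leqnn _).
rewrite kE in kr; apply: le_trans (sqrt_bracket_ge x) _.
have h := tensor_weight_axis_bound r0 (ler0n R n.+1) (iso_weight_insert_max j mx) kr.
apply: le_trans h _.
by rewrite ler_piMr ?box_weight_le1// mulr_ge0// powR_ge0.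
Qed.

(** Each [m] of the cube of radius [M] admits at most a constant number of
    small [x], and for the larger ones [iso_weight] is [bracket x] up to the
    factor 1 + eta with (1 + eta)^a = 1 + e.  An [m] outside of that cube admits
    only |x| <= t w(m) with t = r (n+1)^a, and none at all when t w(m) < 1
    because [x] satisfies 1 <= sqrt (bracket x).  This is why these infinitely
    many [m] cost no additive constant: at most 4 t w(m) values of [x] are
    listed, where the 4 covers both signs and the rounding. *)
Lemma counting_upper (M : nat) (e : R) : 0 < e -> exists K : R, forall r : R, 0 <= r ->
  exists B (F : seq (n.+1.-tuple int)), [/\ (M <= B)%N,
    forall k, tensor_weight k <= r * iso_weight R k `^ a -> k \in F
  & (size F)%:R <= n.+1%:R * (K + 2 * (1 + e) * r * box_sum M ^+ n +
      4 * n.+1%:R `^ a * r * (box_sum B ^+ n - box_sum M ^+ n))].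
Proof.
move=> e0.
pose eta := (1 + e) `^ a^-1 - 1.
have e1 : 0 < 1 + e by rewrite addr_gt0.
have eta0 : 0 < eta.
  rewrite subr_gt0; suff : 1 `^ a^-1 < (1 + e) `^ a^-1 by rewrite powR1.
  by rewrite gt0_ltr_powR ?invr_gt0 ?nnegrE ?(ltW e1) ?ltrDl.
pose X := (Num.truncn ((n * M ^ 2)%:R / eta)).+1.
have Xeta x : (X <= `|x|)%N -> bracket x + (n * M ^ 2)%:R <= (1 + eta) * bracket x.
  move=> Xx; rewrite mulrDl mul1r lerD2l.
  have h : (n * M ^ 2)%:R / eta <= (`|x|%N)%:R.
    by apply: le_trans (ltW (truncnS_gt _)) _; rewrite ler_nat.
  rewrite mulrC -ler_pdivrMr//; apply: le_trans h _.
  by rewrite /bracket -intr_absz; have := normr_ge0 (x%:~R : R); nra.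
have etaa : (1 + eta) `^ a = 1 + e.
  by rewrite addrC subrK -powRrM mulVf ?gt_eqF// powRr1// ltW.
exists ((2 * X.+1 * M.*2.+1 ^ n)%:R) => r r0.
pose t := r * n.+1%:R `^ a.
have t0 : 0 <= t by rewrite mulr_ge0 ?powR_ge0.
pose B := maxn M (Num.truncn t).+1.
have MB : (M <= B)%N by exact: leq_maxl.
pose y (m : {ffun 'I_n -> 'I_B.*2.+1}) := signed_range 0
  (if in_box M m then X + (Num.truncn (r * (1 + e) * box_weight m)).+1
   else if (1 <= t * box_weight m)%R then (Num.truncn (t * box_weight m)).+1 else 0)%N.
exists B, (axis_boxes y); split => //.
- move=> k kr; apply/axis_boxesP.
  have [j /(_ B) jB] := max_coord_bounds r0 kr.
  have [|m [kE mx]] := jB.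
    rewrite -/t; apply: ltW; apply: lt_le_trans (truncnS_gt t) _.
    by rewrite ler_nat leq_maxr.
  exists j, m, (tnth k j); split => //; move: (tnth k j) kE mx => x kE mx.
  rewrite kE in kr; rewrite mem_signed_range add0n /=.
  have wm := box_weight_gt0 m.
  case: ifPn => mM.
    have [xX|Xx] := ltnP `|x| X; first by rewrite (leq_trans xX)// leq_addr.
    apply: (@leq_trans (Num.truncn (r * (1 + e) * box_weight m)).+1); last exact: leq_addl.
    rewrite ltnS truncn_ge_nat; last first.
      by apply: mulr_ge0; [apply: mulr_ge0 => //|]; apply: ltW.
    apply: le_trans (sqrt_bracket_ge x) _; rewrite -etaa.
    have eta1 : 0 <= 1 + eta by rewrite addr_ge0// ltW.
    apply: (tensor_weight_axis_bound r0 eta1 _ kr).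
    exact: le_trans (iso_weight_insert_box j x mM) (Xeta _ Xx).
  have h : Num.sqrt (bracket x) <= t * box_weight m.
    by apply: (tensor_weight_axis_bound r0 _ _ kr) => //; exact: iso_weight_insert_max.
  rewrite (le_trans (sqrt_bracket_ge1 x) h) ltnS truncn_ge_nat.
    exact: le_trans (sqrt_bracket_ge x) h.
  by rewrite mulr_ge0// ltW.
rewrite size_axis_boxes natrM ler_wpM2l//.
have -> : box_sum B ^+ n - box_sum M ^+ n =
    \sum_(m : {ffun 'I_n -> 'I_B.*2.+1} | ~~ in_box M m) box_weight m.
  rewrite -(sum_box_weightT B) -(sum_box_weight MB) (bigID (@in_box n M B)) /=.
  by rewrite addrAC subrr add0r.
rewrite -(sum_box_weight MB).
rewrite (bigID (@in_box n M B)) /= natrD lerD//; last first.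
  rewrite natr_sum mulr_sumr ler_sum// => m mM.
  have wm := box_weight_gt0 m.
  rewrite /y (negbTE mM) size_signed_range -muln2 natrM -/t.
  have -> : 4 * n.+1%:R `^ a * r = 4 * t by rewrite /t; ring.
  case: ifPn => [t1|_]; last by rewrite mul0r !mulr_ge0// ltW.
  have : (Num.truncn (t * box_weight m))%:R <= t * box_weight m.
    by rewrite truncn_le (le_trans ler01 t1).
  rewrite -natr1; lra.
have -> : (2 * X.+1 * M.*2.+1 ^ n)%:R =
    \sum_(m : {ffun 'I_n -> 'I_B.*2.+1} | in_box M m) (2 * X.+1)%:R :> R.
  by rewrite sumr_const (card_in_box _ MB) -mulrnA.
rewrite mulr_sumr -big_split /= natr_sum ler_sum// => m mM.
rewrite /y mM size_signed_range -muln2 !natrM natrD -!natr1.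
have : (Num.truncn (r * (1 + e) * box_weight m))%:R <= r * (1 + e) * box_weight m.
  by rewrite truncn_le !mulr_ge0// ltW// box_weight_gt0.
lra.
Qed.

End counting.

(** * Asymptotics of the counting function *)

Section axis_series.
Context (R : realType).

(** With y = x + 1, this is y^(-g) (e^(g ln (y / x)) - 1) bounded below
    through e^u >= 1 + u and ln (x / y) <= x / y - 1. *)
Lemma powR_telescope (g x : R) : 0 < g -> 0 < x ->
  g * (x + 1) `^ (- (1 + g)) <= x `^ (- g) - (x + 1) `^ (- g).
Proof.
move=> g0 x0; have y0 : 0 < x + 1 by rewrite addr_gt0.
have xy : 1 + - (x + 1)^-1 = x / (x + 1) by field; rewrite gt_eqF.
have lnxy : ln x - ln (x + 1) <= - (x + 1)^-1.
  rewrite -ln_div ?posrE// -xy le_ln1Dx// ltrN2 invf_lt1// ltrDr//.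
have xE : x `^ (- g) = (x + 1) `^ (- g) * expR (g * (ln (x + 1) - ln x)).
  rewrite /powR !gt_eqF// -expRD; congr expR; ring.
have -> : (x + 1) `^ (- (1 + g)) = (x + 1) `^ (- g) / (x + 1).
  rewrite opprD (addrC (- 1)) powRD; last by apply/implyP => _; rewrite gt_eqF.
  by rewrite powR_inv1// ltW.
rewrite xE -[X in _ - X]mulr1 -mulrBr mulrCA ler_wpM2l ?powR_ge0//.
have h : g / (x + 1) <= g * (ln (x + 1) - ln x).
  by rewrite ler_wpM2l ?(ltW g0)//; lra.
have := expR_ge1Dx (g * (ln (x + 1) - ln x)); lra.
Qed.

Definition axis_series (b : R) (n : nat) : R :=
  \sum_(1 <= k < n.+1) ((k%:R ^+ 2 + 1) `^ b)^-1.

Lemma axis_series_nondecreasing b :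
  {homo axis_series b : m n / (m <= n)%N >-> m <= n}.
Proof.
apply/nondecreasing_seqP => n; rewrite /axis_series [leRHS]big_nat_recr//= lerDl.
by rewrite invr_ge0 powR_ge0.
Qed.

(** The terms are dominated by those of the Riemann series of exponent
    1 + 2 a, which telescope by [powR_telescope]. *)
Lemma axis_series_bounded (a : R) n : 0 < a ->
  axis_series (a + 2^-1) n <= 1 + (2 * a)^-1.
Proof.
move=> a0; set g := 2 * a; have g0 : 0 < g by rewrite mulr_gt0.
apply: (@le_trans _ _ (axis_series (a + 2^-1) n.+1)).
  exact: axis_series_nondecreasing.
have term (k : nat) : (k.+1%:R ^+ 2 + 1) `^ (a + 2^-1) >= k.+1%:R `^ (1 + g) :> R.
  have -> : 1 + g = 2 * (a + 2^-1) by rewrite /g; field.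
  rewrite powRrM powR_mulrn// ge0_ler_powR ?nnegrE ?addr_ge0// ?lerDl//.
    by rewrite (ltW a0).
suff : axis_series (a + 2^-1) n.+1 <= 1 + g^-1 * (1 - n.+1%:R `^ (- g)).
  by move/le_trans; apply; rewrite lerD2l ler_piMr ?invr_ge0 ?(ltW g0)//.
elim: n => [|n IH].
  rewrite /axis_series big_nat1 powR1 subrr mulr0 addr0.
  rewrite invf_le1; first by apply: le_trans (term 0%N); rewrite powR1.
  by rewrite powR_gt0// addr_gt0.
rewrite /axis_series big_nat_recr//= -/(axis_series _ _).
have T := @powR_telescope g n.+1%:R g0 (ltr0Sn _ _).
have U : ((n.+2%:R ^+ 2 + 1) `^ (a + 2^-1))^-1 <= g^-1 * (g * n.+2%:R `^ (- (1 + g))) :> R.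
  rewrite mulrA mulVf ?gt_eqF// mul1r powRN lef_pV2 ?posrE ?powR_gt0 ?addr_gt0//.
apply: le_trans (lerD IH U) _.
rewrite -addrA lerD2l -mulrDr ler_wpM2l ?invr_ge0 ?(ltW g0)//.
move: T; rewrite natr1; lra.
Qed.

Lemma axis_series_cvg (a : R) : 0 < a -> cvgn (axis_series (a + 2^-1)).
Proof.
move=> a0; apply: nondecreasing_is_cvgn; first exact: axis_series_nondecreasing.
by exists (1 + (2 * a)^-1) => _ [n _ <-]; exact: axis_series_bounded.
Qed.

Lemma box_sum_series (a : R) B : box_sum a B = 1 + 2 * axis_series (a + 2^-1) B.
Proof.
rewrite box_sumE; congr (_ + _ * _); apply: eq_bigr => k _.
by rewrite /axis_weight /bracket intr_absz absz_nat addrC.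
Qed.

(** The sum of [axis_weight a] over all integers. *)
Definition box_limit (a : R) : R := 1 + 2 * limn (axis_series (a + 2^-1)).

Lemma box_sum_le_limit (a : R) B : 0 < a -> box_sum a B <= box_limit a.
Proof.
move=> a0; rewrite box_sum_series lerD2l ler_wpM2l// nondecreasing_cvgn_le//.
  exact: axis_series_nondecreasing.
exact: axis_series_cvg.
Qed.

Lemma box_sum_ge1 (a : R) B : 1 <= box_sum a B.
Proof.
by rewrite box_sum_series lerDl mulr_ge0// sumr_ge0// => k _; rewrite invr_ge0 powR_ge0.
Qed.

Lemma box_limit_ge1 (a : R) : 0 < a -> 1 <= box_limit a.
Proof. by move=> a0; apply: le_trans (box_sum_ge1 a 0) (box_sum_le_limit _ a0). Qed.

Lemma box_sumX_cvg (a : R) n : 0 < a -> box_sum a B ^+ n @[B --> \oo] --> box_limit a ^+ n.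
Proof.
move=> a0; have cb : box_sum a B @[B --> \oo] --> box_limit a.
  rewrite (_ : box_sum a = fun B => 1 + 2 * axis_series (a + 2^-1) B); last first.
    by apply/funext => B; exact: box_sum_series.
  by apply: cvgD; [exact: cvg_cst|apply: cvgMl_tmp; exact: axis_series_cvg].
exact: (continuous_cvg _ (@exprn_continuous R n (box_limit a)) cb).
Qed.

Lemma box_sumX_approx (a : R) n (e : R) : 0 < a -> 0 < e ->
  exists M, box_limit a ^+ n - e < box_sum a M ^+ n.
Proof.
move=> a0 e0; have /cvgrPdist_lt/(_ e e0) := @box_sumX_cvg a n a0.
move=> [M _ /(_ M (leqnn M))] /=; rewrite ltr_norml => /andP[_ h]; exists M.
lra.
Qed.

Definition counting_const (a : R) (n : nat) : R := n.+1%:R * (2 * box_limit a ^+ n).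

Lemma counting_const_gt0 (a : R) n : 0 < a -> 0 < counting_const a n.
Proof.
move=> a0; rewrite mulr_gt0// mulr_gt0// exprn_gt0//.
exact: lt_le_trans ltr01 (box_limit_ge1 a0).
Qed.

Lemma counting_asymptotic_lower (a : R) n C : 0 < a -> C < counting_const a n ->
  exists r0 : R, forall r, r0 <= r -> exists F : seq (n.+1.-tuple int),
  [/\ uniq F, forall k, k \in F -> tensor_weight a k <= r * iso_weight R k `^ a
    & C * r <= (size F)%:R].
Proof.
move=> a0 Cc; pose N : R := n.+1%:R; have N0 : 0 < N by exact: ltr0Sn.
(* Half of the gap pays for the truncation at M, the other half for K. *)
pose e := (counting_const a n - C) / (4 * N).
have e0 : 0 < e by rewrite divr_gt0 ?subr_gt0// mulr_gt0.
have [M hM] := box_sumX_approx n a0 e0.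
pose K : R := (M.+2 * M.*2.+1 ^ n)%:R; have K0 : 0 <= K by exact: ler0n.
exists (K / e) => r rK; have r0 : 0 <= r.
  by apply: le_trans rK; rewrite divr_ge0 ?(ltW e0).
have [F [uF kF sF]] := counting_lower a0 n M r.
exists F; split => //; apply: le_trans sF; rewrite -/N -/K.
have CE : C = N * (2 * (box_limit a ^+ n - 2 * e)).
  by rewrite /e /counting_const -/N; field; rewrite gt_eqF.
rewrite CE -!mulrA ler_wpM2l ?(ltW N0)// ler_wpM2l// mulrC.
have Kr : K <= r * e by rewrite -ler_pdivrMr.
have : r * (box_limit a ^+ n - e) <= r * box_sum a M ^+ n by rewrite ler_wpM2l// ltW.
lra.
Qed.

Lemma counting_asymptotic_upper (a : R) n C : 0 < a -> counting_const a n < C ->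
  exists r0 : R, forall r, r0 <= r -> exists F : seq (n.+1.-tuple int),
  (forall k, tensor_weight a k <= r * iso_weight R k `^ a -> k \in F) /\
  (size F)%:R <= C * r.
Proof.
move=> a0 Cc; pose N : R := n.+1%:R; have N0 : 0 < N by exact: ltr0Sn.
pose D := N `^ a; have D0 : 0 < D by exact: powR_gt0.
(* A third of the gap for each of: the factor 1 + e of the cube of radius M,
   the points outside of that cube, and the constant K. *)
pose e := (C - counting_const a n) / (3 * N).
have e0 : 0 < e by rewrite divr_gt0 ?subr_gt0// mulr_gt0.
pose Z := box_limit a ^+ n.
have Z0 : 0 < Z by rewrite exprn_gt0// (lt_le_trans ltr01 (box_limit_ge1 a0)).
have [M hM] := box_sumX_approx n a0 (divr_gt0 e0 (mulr_gt0 (ltr0Sn R 3) D0)).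
have [K HK] := counting_upper a0 n M (divr_gt0 e0 (mulr_gt0 (ltr0Sn R 1) Z0)).
exists (Num.max 0 (K / e)) => r; rewrite ge_max => /andP[r0 rK].
have [B [F [MB kF sF]]] := HK r r0.
exists F; split => //; apply: le_trans sF _; rewrite -/N -/D.
have CE : C = N * (2 * Z + 3 * e).
  by rewrite /e /counting_const -/N /Z; field; rewrite gt_eqF.
clearbody e; rewrite CE -!mulrA ler_wpM2l ?(ltW N0)//.
have Kr : K <= r * e by rewrite -ler_pdivrMr.
set zM := box_sum a M ^+ n; set zB := box_sum a B ^+ n.
have zMZ : zM <= Z.
  by rewrite lerXn2r ?nnegrE ?box_sum_le_limit// (le_trans ler01) ?box_sum_ge1 ?box_limit_ge1.
have zBZ : zB <= Z.
  by rewrite lerXn2r ?nnegrE ?box_sum_le_limit// (le_trans ler01) ?box_sum_ge1 ?box_limit_ge1.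
have h1 : 2 * ((1 + e / (2 * Z)) * (r * zM)) <= 2 * r * Z + r * e.
  rewrite [leRHS](_ : _ = 2 * ((1 + e / (2 * Z)) * (r * Z))); last by field; rewrite gt_eqF.
  rewrite ler_wpM2l// ler_wpM2l ?addr_ge0 ?divr_ge0 ?mulr_ge0 ?(ltW e0) ?(ltW Z0)//.
  by rewrite ler_wpM2l.
have h2 : 4 * (D * (r * (zB - zM))) <= r * e.
  rewrite [leRHS](_ : _ = 4 * (D * (r * (e / (4 * D))))); last by field; rewrite gt_eqF.
  rewrite ler_wpM2l// ler_wpM2l ?(ltW D0)// ler_wpM2l//.
  by move: hM; rewrite -/Z -/zM; lra.
move: h1 h2 Kr; lra.
Qed.

End axis_series.

(** * Asymptotics of the approximation numbers *)

Lemma powR_prod (R : realType) I (r : seq I) (f : I -> R) c :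
  (forall i, 0 <= f i) -> (\prod_(i <- r) f i) `^ c = \prod_(i <- r) f i `^ c.
Proof.
move=> f0; elim: r => [|i r IH]; first by rewrite !big_nil powR1.
by rewrite !big_cons powRM ?IH// prodr_ge0.
Qed.

Lemma powR_divN (R : realType) (x y c : R) : 0 < x -> 0 < y ->
  (x / y) `^ (- c) = y `^ c * x `^ (- c).
Proof.
move=> x0 y0; rewrite !powRN.
have -> : x `^ c = (x / y) `^ c * y `^ c.
  by rewrite -powRM ?(ltW y0) ?divr_ge0 ?(ltW x0)// ?(ltW y0)// divfK// gt_eqF.
have h1 : 0 < (x / y) `^ c by rewrite powR_gt0// divr_gt0.
have h2 : 0 < y `^ c by rewrite powR_gt0.
by field; rewrite !gt_eqF.
Qed.

Section approximation_asymptotics.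
Context (R : realType) (n : nat) (s : R).
Context (s1 : 1 < s).

Let p : R := s - 1.
Let a : R := (2 * p)^-1.
Local Notation a_ := (approx_number (@Hmix_norm R n.+1 s) (@H1iso_norm R n.+1)
  (embed (d := n.+1) s1)).

Let p0 : 0 < p. Proof. by rewrite subr_gt0. Qed.
Let a0 : 0 < a. Proof. by rewrite invr_gt0 mulr_gt0. Qed.

Lemma mix_weight_tensor (k : n.+1.-tuple int) :
  mix_weight s k = tensor_weight a k `^ (2 * p).
Proof.
rewrite /mix_weight /tensor_weight.
have E : (a + 2^-1) * (2 * p) = s.
  by rewrite /a /p; field; rewrite gt_eqF// subr_gt0.
rewrite powR_prod => [|i]; last exact: powR_ge0.
by apply: eq_bigr => i _; rewrite -powRrM E.
Qed.

Lemma tensor_weight_ge0 (k : n.+1.-tuple int) : 0 <= tensor_weight a k.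
Proof. by apply: prodr_ge0 => i _; exact: powR_ge0. Qed.

Lemma iso_powK (k : n.+1.-tuple int) r : 0 <= r ->
  (r * iso_weight R k `^ a) `^ (2 * p) = (r `^ p) ^+ 2 * iso_weight R k.
Proof.
move=> r0; rewrite powRM ?powR_ge0// -powRrM mulVf ?gt_eqF ?mulr_gt0//.
rewrite powRr1 ?iso_weight_ge0//; congr (_ * _).
by rewrite [2 * p]mulrC powRrM powR_mulrn// powR_ge0.
Qed.

(** Write v = C^p with C below the counting constant and take r = m / C: the
    level set of [r] has at least C r = m points. *)
Lemma approx_number_eventually_ge (v : R) : 0 < v -> v < counting_const a n `^ p ->
  exists m0, forall m, (m0 <= m)%N -> ((v * m%:R `^ (- p))%:E <= a_ m)%E.
Proof.
move=> v0 vC; pose C := v `^ p^-1; have C0 : 0 < C by exact: powR_gt0.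
have c0 := counting_const_gt0 n a0.
have Cp : C `^ p = v by rewrite -powRrM mulVf ?gt_eqF// powRr1// ltW.
have Cc : C < counting_const a n.
  rewrite ltNge; apply/negP => h; move: vC; rewrite ltNge => /negP; apply.
  by rewrite -Cp ge0_ler_powR ?nnegrE ?(ltW C0) ?(ltW c0)// ltW.
have [r0 Hr] := counting_asymptotic_lower a0 Cc.
exists (Num.truncn (r0 * C)).+1 => m mm.
have m0 : 0 < m%:R :> R by rewrite ltr0n; apply: leq_trans mm.
pose r := m%:R / C; have r_gt0 : 0 < r by rewrite divr_gt0.
have rr : r0 <= r.
  rewrite ler_pdivlMr//; apply: le_trans (ltW (truncnS_gt _)) _.
  by rewrite ler_nat.
have [F [uF kF sF]] := Hr r rr.
have {}sF : (m <= size F)%N.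
  by move: sF; rewrite /r mulrCA divff ?gt_eqF// mulr1 ler_nat.
have -> : v * m%:R `^ (- p) = r `^ (- p).
  by rewrite powR_divN// Cp.
pose f (i : 'I_m) := nth [tuple 0 | _ < n.+1] F i.
have fF i : f i \in F by rewrite mem_nth// (leq_trans (ltn_ord i)).
apply: (@le_approx_number _ _ _ s1 m f) => [|i j /eqP|i].
- exact: powR_ge0.
- rewrite nth_uniq ?(leq_trans (ltn_ord _))// => /eqP ij.
  exact: val_inj.
- have := kF _ (fF i); move: (f i) => k kr.
  rewrite powRN exprVn mulrC ler_pdivrMr ?exprn_gt0 ?powR_gt0// mulrC.
  rewrite -iso_powK ?(ltW r_gt0)// mix_weight_tensor.
  have rk0 : 0 <= r * iso_weight R k `^ a := mulr_ge0 (ltW r_gt0) (powR_ge0 _ _).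
  have p2 : 0 <= 2 * p := ltW (mulr_gt0 (ltr0Sn R 1) p0).
  by rewrite ge0_ler_powR ?nnegrE ?tensor_weight_ge0.
Qed.

(** Write v = C^p with C above the counting constant and take r = m / C: the
    level set of [r] is covered by fewer than C r = m points, because the
    counting bound holds with a constant strictly below C. *)
Lemma approx_number_eventually_le (v : R) : counting_const a n `^ p < v ->
  exists m0, forall m, (m0 <= m)%N -> (a_ m <= (v * m%:R `^ (- p))%:E)%E.
Proof.
move=> vC; have v0 : 0 < v by apply: le_lt_trans vC; exact: powR_ge0.
pose C := v `^ p^-1; have C0 : 0 < C by exact: powR_gt0.
have c0 := counting_const_gt0 n a0.
have Cp : C `^ p = v by rewrite -powRrM mulVf ?gt_eqF// powRr1// ltW.
have Cc : counting_const a n < C.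
  rewrite ltNge; apply/negP => h; move: vC; rewrite ltNge => /negP; apply.
  by rewrite -Cp ge0_ler_powR ?nnegrE ?(ltW C0) ?(ltW c0)// ltW.
have [r0 Hr] := counting_asymptotic_upper a0 (midf_lt Cc).1.
exists (Num.truncn (r0 * C)).+1 => m mm.
have m0 : 0 < m%:R :> R by rewrite ltr0n; apply: leq_trans mm.
pose r := m%:R / C; have r_gt0 : 0 < r by rewrite divr_gt0.
have rr : r0 <= r.
  rewrite ler_pdivlMr//; apply: le_trans (ltW (truncnS_gt _)) _.
  by rewrite ler_nat.
have [F [kF sF]] := Hr r rr.
have {}sF : (size F < m)%N.
  rewrite -(ltr_nat R); apply: le_lt_trans sF _.
  have -> : m%:R = C * r by rewrite /r mulrCA divff ?gt_eqF// mulr1.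
  by rewrite ltr_pM2r// (midf_lt Cc).2.
have -> : v * m%:R `^ (- p) = r `^ (- p).
  by rewrite powR_divN// Cp.
apply: (@approx_number_le _ _ _ s1 F) => // [|k kF'].
- exact: powR_ge0.
- have kr : r * iso_weight R k `^ a <= tensor_weight a k.
    by rewrite leNgt; apply: contra kF' => /ltW; exact: kF.
  rewrite powRN exprVn mulrC ler_pdivlMr ?exprn_gt0 ?powR_gt0// mulrC.
  rewrite -iso_powK ?(ltW r_gt0)// mix_weight_tensor.
  have rk0 : 0 <= r * iso_weight R k `^ a := mulr_ge0 (ltW r_gt0) (powR_ge0 _ _).
  have p2 : 0 <= 2 * p := ltW (mulr_gt0 (ltr0Sn R 1) p0).
  by rewrite ge0_ler_powR ?nnegrE ?tensor_weight_ge0.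
Qed.

Lemma approx_number_cvg :
  (fun m => a_ m / (m%:R `^ (- p))%:E)%E @ \oo --> (counting_const a n `^ p)%:E.
Proof.
have c0 := counting_const_gt0 n a0.
set L := counting_const a n `^ p; have L0 : 0 < L by exact: powR_gt0.
have lower v : 0 < v -> v < L ->
    \forall m \near \oo, (v%:E <= a_ m / (m%:R `^ (- p))%:E)%E.
  move=> v0 vL; have [m0 H] := approx_number_eventually_ge v0 vL.
  near=> m; have mm : (0 < m)%N by near: m; exact: nbhs_infty_gt.
  have mp : 0 < m%:R `^ (- p) :> R by rewrite powR_gt0 ?ltr0n.
  rewrite inver gt_eqF// lee_pdivlMr// -EFinM; apply: H.
  by near: m; exact: nbhs_infty_ge.
have upper v : L < v ->
    \forall m \near \oo, (a_ m / (m%:R `^ (- p))%:E <= v%:E)%E.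
  move=> vL; have [m0 H] := approx_number_eventually_le vL.
  near=> m; have mm : (0 < m)%N by near: m; exact: nbhs_infty_gt.
  have mp : 0 < m%:R `^ (- p) :> R by rewrite powR_gt0 ?ltr0n.
  rewrite inver gt_eqF// lee_pdivrMr// -EFinM; apply: H.
  by near: m; exact: nbhs_infty_ge.
have fin (x : \bar R) (u v : R) : (u%:E <= x)%E -> (x <= v%:E)%E -> x \is a fin_num.
  by case: x.
apply/fine_cvgP; split.
  near=> m; apply: (@fin _ (L / 2) (L + 1)); near: m.
    by apply: lower; [rewrite divr_gt0|rewrite ltr_pdivrMr// ltr_pMr// ltr1n].
  by apply: upper; rewrite ltrDl.
apply/cvgrPdist_le => e e0.
pose u := Num.max (L / 2) (L - e).
have u0 : 0 < u by rewrite lt_max divr_gt0.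
have uL : u < L by rewrite gt_max ltrBlDr ltrDl e0 andbT ltr_pdivrMr// ltr_pMr// ltr1n.
have vL : L < L + e by rewrite ltrDl.
near=> m.
have h1 : (u%:E <= a_ m / (m%:R `^ (- p))%:E)%E by near: m; exact: lower.
have h2 : (a_ m / (m%:R `^ (- p))%:E <= (L + e)%:E)%E by near: m; exact: upper.
rewrite /=; move: h1 h2; set x := (_ / _)%E; move=> h1 h2.
have xf := fin _ _ _ h1 h2.
move: h1 h2; rewrite -{1 2}(fineK xf) !lee_fin => h1 h2.
move: h1; rewrite /u ge_max => /andP[_ h1].
by rewrite ler_distl lerBlDr h2 -lerBlDr h1.
Unshelve. all: by end_near.
Qed.

End approximation_asymptotics.

Theorem theorem5p1 (R : realType) (d : nat) (s : R)
    (hd : (0 < d)%N) (hs : 1 < s) :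
  let S : R := limn (fun n : nat =>
    \sum_(1 <= k < n.+1) ((k%:R ^+ 2 + 1) `^ (s / (2 * (s - 1))))^-1) in
  (fun n : nat => approx_number (@Hmix_norm R d s) (@H1iso_norm R d)
                    (embed (d := d) hs) n / (n%:R `^ (- s + 1))%:E)%E @ \oo -->
  ((2 * d%:R) `^ (s - 1) * (2 * S + 1) `^ ((s - 1) * (d%:R - 1)))%:E.
Proof.
case: d hd => // n _ S.
have s0 : 0 < s - 1 by rewrite subr_gt0.
have a0 : 0 < (2 * (s - 1))^-1 by rewrite invr_gt0 mulr_gt0.
have bE : s / (2 * (s - 1)) = (2 * (s - 1))^-1 + 2^-1 by field; rewrite gt_eqF.
have ZE : 2 * S + 1 = box_limit (2 * (s - 1))^-1.
  by rewrite addrC /S bE.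
have Z1 := box_limit_ge1 a0; have Z0 := lt_le_trans ltr01 Z1.
have -> : - s + 1 = - (s - 1) by rewrite opprB addrC.
have -> : n.+1%:R - 1 = n%:R :> R by rewrite -(natr1 n) addrK.
rewrite ZE; set Z := box_limit _.
have -> : Z `^ ((s - 1) * n%:R) = (Z ^+ n) `^ (s - 1).
  by rewrite mulrC powRrM powR_mulrn// ltW.
rewrite -powRM ?mulr_ge0 ?exprn_ge0 ?(ltW Z0)//.
have -> : 2 * n.+1%:R * Z ^+ n = counting_const (2 * (s - 1))^-1 n.
  by rewrite /counting_const -/Z; ring.
exact: approx_number_cvg.
Qed.
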